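(* Let $X$ be a Boolean space. For all ordinals $\alpha$, $C(X^{(\alpha)},\mathbb{Z})\cong C(X,\mathbb{Z})/C_{\alpha}$ as lattice ordered abelian groups. In particular, if $X$ has Cantor-Bendixson rank $\beta$ then $C(X,\mathbb{Z})_\infty^+$ has m-dimension $\beta+1$.
   Context: A space is Boolean if it is Hausdorff, compact and totally disconnected. $C(X,\mathbb{Z})$ is the lattice ordered abelian group ($\ell$-group) of continuous functions $X\to\mathbb{Z}$ ($\mathbb{Z}$ discrete) with pointwise operations and order. For an $\ell$-group $\Gamma$, $\Gamma^+$ is its positive cone and $\Gamma_\infty^+=\Gamma^+\cup\{\infty\}$ with $\infty$ a new top element. Cantor-Bendixson: $X^{(0)}=X$, $X^{(\alpha+1)}$ is the set of non-isolated points of $X^{(\alpha)}$, $X^{(\lambda)}=\bigcap_{\alpha<\lambda}X^{(\alpha)}$ for limit $\lambda$; the CB rank of a non-empty space $X$ is the supremum of all $\alpha$ with $X^{(\alpha)}\neq\emptyset$ if it exists and $\infty$ otherwise. The subgroups $C_\alpha$: for an $\ell$-group $\Gamma$, let $C_{1}(\Gamma)$ be the set of $a\in\Gamma$ such that there is a finite chain $a\wedge 0=c_0\leq c_1\leq\cdots\leq c_n=a\vee 0$ with each interval $[c_i,c_{i+1}]$ having at most two elements; this is a convex $\ell$-subgroup. Put $C_0(\Gamma)=\{0\}$, let $C_{\alpha+1}(\Gamma)$ be the preimage in $\Gamma$ of $C_1(\Gamma/C_\alpha(\Gamma))$, and $C_\lambda(\Gamma)=\bigcup_{\alpha<\lambda}C_\alpha(\Gamma)$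 for limit $\lambda$. Here $C_\alpha:=C_\alpha(C(X,\mathbb{Z}))$. m-dimension: for a bounded modular lattice $L$, let $\sim$ be the smallest congruence identifying the endpoints of every interval with at most two elements. Put $L_0=L$, $L_{\alpha+1}=L_\alpha/\!\sim$, and for limit $\lambda$ let $L_\lambda$ be the quotient of $L$ by the union of the kernels of $L\to L_\alpha$, $\alpha<\lambda$. If $L$ has at least two elements and some $L_\alpha$ is a one-point lattice, then the least such $\alpha$ is a successor and the m-dimension of $L$ is $\alpha-1$; otherwise $L$ does not have m-dimension. *)

(* Defs.v *)
From HB Require Import structures.
From mathcomp Require Import all_boot all_order all_algebra.
From mathcomp Require Import generic_quotient ring_quotient.
From mathcomp Require Import all_classical topology.

Set Implicit Arguments.
Unset Strict Implicit.
Unset Printing Implicit Defensive.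

Import Order.TTheory GRing.Theory Num.Theory.

Local Open Scope classical_set_scope.
Local Open Scope quotient_scope.
Local Open Scope ring_scope.

(* Ordinals.  A type of ordinals is a well-order without a greatest element,
   thought of as the ordinals below some limit ordinal.  Every ordinal
   [alpha] is an element of such a well-order (e.g. of [alpha + omega]), so a
   statement about all ordinals is quantified over all [ordType]s and all of
   their elements.  Zero, successors, limits, suprema and least elements
   computed in an [ordType] are those computed among all ordinals, as it is
   an initial segment of the ordinals closed under successor. *)

HB.mixin Record isOrdinals d W & Order.Total d W := {
  ord_wf : well_founded (fun a b : W => (a < b)%O);
  ord_noMax : forall a : W, exists b : W, (a < b)%O
}.

#[short(type="ordType")]
HB.structure Definition Ordinals d := {W of Order.Total d W & isOrdinals d W}.

Section Ordinals.
Context {d : Order.disp_t} {W : ordType d}.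
Implicit Types a b c : W.

Definition is_succ a b := (a < b)%O /\ forall c, (a < c)%O -> (b <= c)%O.

Definition is_zero a := forall b, (a <= b)%O.

Definition is_limit a := ~ is_zero a /\ forall b, ~ is_succ b a.

Lemma ord_least (A : set W) : A !=set0 ->
  exists a, A a /\ forall b, A b -> (a <= b)%O.
Proof.
case=> a Aa; apply: contrapT => nA.
suff H b : ~ A b by exact: (H a Aa).
elim/(well_founded_ind (@ord_wf d W)): b => b IH Ab; apply: nA; exists b; split=> //.
by move=> c Ac; rewrite leNgt; apply/negP => cb; exact: IH c cb Ac.
Qed.

Lemma ord_succ_ex a : exists b, is_succ a b.
Proof. by have [b [ab H]] := ord_least (ord_noMax a); exists b; split. Qed.

Definition osucc a : W := sval (cid (ord_succ_ex a)).

Lemma osuccP a : is_succ a (osucc a).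
Proof. exact: svalP (cid (ord_succ_ex a)). Qed.

Lemma is_succ_inj a a' b : is_succ a b -> is_succ a' b -> a = a'.
Proof.
move=> [ab Ha] [a'b Ha']; apply/le_anti/andP; split.
  by rewrite leNgt; apply/negP => /Ha'; rewrite leNgt ab.
by rewrite leNgt; apply/negP => /Ha; rewrite leNgt a'b.
Qed.

Lemma is_succ_lt a b c : is_succ a b -> (c < b)%O -> (c <= a)%O.
Proof. by move=> [_ H] cb; rewrite leNgt; apply/negP => /H; rewrite leNgt cb. Qed.

Lemma zeroNsucc a b : is_zero b -> ~ is_succ a b.
Proof. by move=> /(_ a) + [ab _]; rewrite leNgt ab. Qed.

Variant ord_spec a : Prop :=
| OrdZero of is_zero a
| OrdSucc b of is_succ b a
| OrdLimit of is_limit a.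

Lemma ordP a : ord_spec a.
Proof.
have [|z] := pselect (is_zero a); first exact: OrdZero.
have [[b]|s] := pselect (exists b, is_succ b a); first exact: OrdSucc.
by apply: OrdLimit; split=> // b ba; apply: s; exists b.
Qed.

Section Rec.
Variables (T : Type) (z : T) (s : T -> T) (l : set T -> T).

(* Transfinite recursion: value [z] at zero, [s] at successors, and [l]
   applied to the set of all previous values at limits. *)
Definition trec : W -> T := Fix (@ord_wf d W) (fun=> T) (fun a rec =>
  if pselect (is_zero a) then z else
  if pselect (exists b, is_succ b a) is left h then
    s (rec (sval (cid h)) (svalP (cid h)).1)
  else l [set t | exists b (ba : (b < a)%O), t = rec b ba]).

Lemma trecE a : trec a =
  if pselect (is_zero a) then z else
  if pselect (exists b, is_succ b a) is left h then s (trec (sval (cid h)))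
  else l [set t | exists b (ba : (b < a)%O), t = trec b].
Proof.
rewrite /trec Fix_eq // => {}a f g fg; congr (if _ then _ else _).
have -> : f = g by apply: functional_extensionality_dep => b; apply/funext => p.
by [].
Qed.

Lemma trec0 a : is_zero a -> trec a = z.
Proof. by move=> a0; rewrite trecE; case: pselect. Qed.

Lemma trecS a b : is_succ a b -> trec b = s (trec a).
Proof.
move=> ab; rewrite trecE; case: (pselect (is_zero b)) => [b0|b0].
  by have := zeroNsucc b0 ab.
case: (pselect (exists a0, is_succ a0 b)) => [h|[]]; last by exists a.
by congr (s (trec _)); apply: is_succ_inj (svalP (cid h)) ab.
Qed.

Lemma trec_lim a : is_limit a -> trec a = l (trec @` [set b | (b < a)%O]).
Proof.
move=> [a0 aS]; rewrite trecE; case: (pselect (is_zero a)) => // n0.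
case: (pselect (exists b, is_succ b a)) => [h|h].
  by exfalso; case: h => b; exact: aS.
congr l; apply/seteqP; split=> t /=; last by move=> [b ba <-]; exists b, ba.
by move=> [b [ba ->]]; exists b.
Qed.

(* An increasing transfinite sequence: [P] holds along it, and [R] relates
   earlier terms to later ones. *)
Lemma trec_chain (P : T -> Prop) (R : T -> T -> Prop) :
  (forall t, R t t) -> (forall t u v, R t u -> R u v -> R t v) -> P z ->
  (forall t, P t -> P (s t) /\ R t (s t)) ->
  (forall F : set T, F !=set0 -> F `<=` P ->
     (forall t u, F t -> F u -> R t u \/ R u t) ->
     P (l F) /\ forall t, F t -> R t (l F)) ->
  forall a, P (trec a) /\ forall b, (b <= a)%O -> R (trec b) (trec a).
Proof.
move=> Rxx Rt Pz Ps Pl; elim/(well_founded_ind (@ord_wf d W)) => a IH.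
have Req b : (b <= a)%O -> ((b < a)%O -> R (trec b) (trec a)) ->
  R (trec b) (trec a).
  by rewrite le_eqVlt => /orP[/eqP->|ba] // /(_ ba).
case: (ordP a) => [a0|c ca|al].
- split; first by rewrite trec0.
  by move=> b /Req; apply; rewrite ltNge a0.
- have [Pc Rc] := IH c ca.1; have [Psc Rsc] := Ps _ Pc.
  rewrite (trecS ca); split=> // b /Req; rewrite (trecS ca); apply => ba.
  exact: Rt (Rc _ (is_succ_lt ca ba)) Rsc.
- have [] := Pl (trec @` [set b | (b < a)%O]).
  + have [a0 _] := al; have /existsNP[b ab] := a0.
    exists (trec b); exists b => //=.
    by rewrite ltNge; apply/negP.
  + by move=> _ [b ba <-]; exact: (IH b ba).1.
  + move=> _ _ [b ba <-] [c ca <-].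
    have [bc|/ltW cb] := leP b c; [left|right].
      exact: (IH c ca).2.
    exact: (IH b ba).2.
  rewrite -trec_lim // => Pa Ra; split=> // b /Req; apply => ba.
  by apply: Ra; exists b.
Qed.

End Rec.
End Ordinals.

Section CantorBendixson.
Context (X : topologicalType) {d : Order.disp_t} {W : ordType d}.

Definition CB_derivative : W -> set X :=
  trec [set: X] (fun A => A `\` isolated A) (fun F => \bigcap_(A in F) A).

Definition has_CB_rank (b : W) : Prop :=
  [set: X] !=set0 /\ supremums [set a : W | CB_derivative a !=set0] b.

End CantorBendixson.

Arguments CB_derivative X {d W}.
Arguments has_CB_rank X {d W}.

Definition boolean_space (X : topologicalType) : Prop :=
  [/\ hausdorff_space X, compact [set: X] & totally_disconnected [set: X]].

(* Lattice-ordered abelian groups.  They are bundled by hand: MathComp already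
   has Num.RealDomain below both Order.Lattice and GRing.Zmodule, and its
   hierarchy cannot be extended with an intermediate join. *)

Record lgroupType := LGroupType {
  lg_zmod : zmodType;
  lg_le : rel lg_zmod;
  lg_meet : lg_zmod -> lg_zmod -> lg_zmod;
  lg_join : lg_zmod -> lg_zmod -> lg_zmod;
  lg_le_refl : reflexive lg_le;
  lg_le_anti : antisymmetric lg_le;
  lg_le_trans : transitive lg_le;
  lg_meetP : forall x y z, lg_le x (lg_meet y z) = lg_le x y && lg_le x z;
  lg_joinP : forall x y z, lg_le (lg_join x y) z = lg_le x z && lg_le y z;
  lg_addP : forall x y z : lg_zmod, lg_le x y -> lg_le (z + x) (z + y)
}.

Definition lg_sort (G : lgroupType) : Type := lg_zmod G.
Coercion lg_sort : lgroupType >-> Sortclass.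

HB.instance Definition _ (G : lgroupType) :=
  GRing.Zmodule.copy (lg_sort G) (lg_zmod G).
HB.instance Definition _ (G : lgroupType) := Order.Le_isPOrder.Build ring_display
  (lg_sort G) (@lg_le_refl G) (@lg_le_anti G) (@lg_le_trans G).
HB.instance Definition _ (G : lgroupType) :=
  Order.POrder_MeetJoin_isLattice.Build ring_display (lg_sort G)
    (@lg_meetP G) (@lg_joinP G).

Local Notation "x /\_ y" := (Order.meet x y) (at level 40, left associativity).
Local Notation "x \/_ y" := (Order.join x y) (at level 40, left associativity).

Definition lgroup_iso (G H : lgroupType) : Prop :=
  exists f : G -> H, [/\ bijective f, {morph f : x y / x + y},
    {morph f : x y / x /\_ y} & {morph f : x y / x \/_ y}].

Section LGroupTheory.
Variable G : lgroupType.
Implicit Types x y z u v : G.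

Lemma lgD2l z x y : x <= y -> z + x <= z + y.
Proof. exact: lg_addP. Qed.

Lemma lg_le2l z x y : (z + x <= z + y) = (x <= y).
Proof.
apply/idP/idP => [|/lgD2l->//].
by move=> /(@lgD2l (- z)); rewrite !addKr.
Qed.

Lemma lg_le2r z x y : (x + z <= y + z) = (x <= y).
Proof. by rewrite ![_ + z]addrC lg_le2l. Qed.

Lemma lg_leD x y u v : x <= y -> u <= v -> x + u <= y + v.
Proof. by move=> xy uv; apply: (@le_trans _ _ (y + u)); rewrite ?lg_le2l ?lg_le2r. Qed.

Lemma lg_leN x y : (- x <= - y) = (y <= x).
Proof. by rewrite -[LHS](lg_le2l x) -[LHS](lg_le2r y) subrr add0r subrK. Qed.

Lemma lg_addl_le x y z : (z + x <= y) = (x <= - z + y).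
Proof. by rewrite -[LHS](lg_le2l (- z)) addKr. Qed.

Lemma lg_le_addl x y z : (x <= z + y) = (- z + x <= y).
Proof. by rewrite lg_addl_le opprK. Qed.

Lemma lg_meetD z x y : z + x /\_ y = (z + x) /\_ (z + y).
Proof.
apply/le_anti/andP; split.
  by rewrite lexI !lg_le2l leIl leIr.
by rewrite lg_le_addl lexI -!lg_le_addl leIl leIr.
Qed.

Lemma lg_joinD z x y : z + x \/_ y = (z + x) \/_ (z + y).
Proof.
apply/le_anti/andP; split; last by rewrite leUx !lg_le2l leUl leUr.
by rewrite lg_addl_le leUx -!lg_addl_le leUl leUr.
Qed.

Lemma lg_oppI x y : - (x /\_ y) = (- x) \/_ (- y).
Proof.
apply/le_anti/andP; split; last by rewrite leUx !lg_leN leIl leIr.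
rewrite -[leRHS]opprK lg_leN lexI -[X in _ <= X]opprK lg_leN leUl /=.
by rewrite -[leRHS]opprK lg_leN leUr.
Qed.

Lemma lg_meet_join x y : x /\_ y + x \/_ y = x + y.
Proof.
apply: (addrI (- (x /\_ y))); rewrite addKr addrC lg_oppI lg_joinD.
by rewrite addrK addrC addKr joinC.
Qed.

Lemma lg_cancel x y z : x /\_ z = y /\_ z -> x \/_ z = y \/_ z -> x = y.
Proof.
by move=> hI hU; apply: (addIr z); rewrite -lg_meet_join hI hU lg_meet_join.
Qed.

Lemma lg_meetUl : left_distributive (@Order.meet _ G) (@Order.join _ G).
Proof.
move=> y z x; rewrite ![_ /\_ x]meetC; apply/le_anti/andP; split; last first.
  by rewrite leUx !leI2 ?leUl ?leUr.
set e := y \/_ z; set w := (x /\_ y) \/_ (x /\_ z).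
have H u : u <= e -> x /\_ u <= w -> (x /\_ e - e) + u <= w.
  move=> ue; apply: le_trans; rewrite lexI; apply/andP; split.
    by rewrite -[leRHS]addr0 -addrA lg_leD ?leIl // addrC -(subrr e) lg_le2r.
  by rewrite -[leRHS]add0r lg_le2r -(subrr e) lg_le2r leIr.
have : ((x /\_ e - e) + y <= w) && ((x /\_ e - e) + z <= w).
  by rewrite !H ?leUl ?leUr.
by rewrite -leUx -lg_joinD subrK.
Qed.
End LGroupTheory.

Section LatticeOfOps.
Variables (Q : choiceType) (m j : Q -> Q -> Q).
Hypotheses (mC : commutative m) (jC : commutative j).
Hypotheses (mA : associative m) (jA : associative j).
Hypotheses (mK : forall x y, m x (j x y) = x) (jK : forall x y, j x (m x y) = x).

Definition ops_le (x y : Q) := m x y == x.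

Let mxx x : m x x = x. Proof. by rewrite -{2}(jK x x) mK. Qed.

Lemma ops_le_refl : reflexive ops_le.
Proof. by move=> x; rewrite /ops_le mxx. Qed.

Lemma ops_le_anti : antisymmetric ops_le.
Proof. by move=> x y /andP[/eqP xy /eqP yx]; rewrite -xy mC yx. Qed.

Lemma ops_le_trans : transitive ops_le.
Proof.
by move=> y x z /eqP xy /eqP yz; apply/eqP; rewrite -xy -mA yz.
Qed.

Lemma ops_leI x y z : ops_le x (m y z) = ops_le x y && ops_le x z.
Proof.
apply/eqP/andP => [<-|[/eqP xy /eqP xz]]; last by rewrite mA xy xz.
rewrite /ops_le; split; last by rewrite -!mA mxx.
by rewrite -!mA (mC z) (mA y y) mxx.
Qed.

Let ops_leE x y : ops_le x y = (j x y == y).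
Proof.
apply/eqP/eqP => <-; last exact: mK.
by rewrite jC mC jK.
Qed.

Let jxx x : j x x = x. Proof. by rewrite -{2}(mK x x) jK. Qed.

Lemma ops_leU x y z : ops_le (j x y) z = ops_le x z && ops_le y z.
Proof.
rewrite !ops_leE; apply/eqP/andP => [<-|[/eqP xz /eqP yz]]; last first.
  by rewrite -jA yz xz.
split; first by rewrite !jA jxx.
by rewrite !jA (jC y) -(jA x y y) jxx.
Qed.

End LatticeOfOps.

Definition convex_lsubgroup (G : lgroupType) (S : set G) : Prop :=
  [/\ S 0, (forall x y, S x -> S y -> S (x - y)),
      (forall x y, S x -> S y -> S (x /\_ y) /\ S (x \/_ y)) &
      (forall x y z, S x -> S y -> x <= z -> z <= y -> S z)].

Record clsub (G : lgroupType) := Clsub {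
  clsub_set :> G -> Prop;
  clsubP : convex_lsubgroup clsub_set
}.

Section Quotient.
Variables (G : lgroupType) (I : clsub G).
Implicit Types x y z : G.

Definition clsub_pred : {pred G} := fun x => `[< I x >].

Lemma clsub_predP x : reflect (I x) (x \in clsub_pred).
Proof. exact: asboolP. Qed.

Lemma clsub_zmod_closed : zmod_closed clsub_pred.
Proof.
have [I0 IB _ _] := clsubP I; split; first exact/clsub_predP.
by move=> x y /clsub_predP Ix /clsub_predP Iy; apply/clsub_predP/IB.
Qed.

HB.instance Definition _ := GRing.isZmodClosed.Build G clsub_pred clsub_zmod_closed.

Let Q := Quotient.quot clsub_pred.

Lemma lquot_eqP x y : \pi_Q x = \pi_Q y <-> I (x - y).
Proof.
split=> [/eqP|/clsub_predP].
  by rewrite -Quotient.idealrBE => /clsub_predP.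
by rewrite Quotient.idealrBE => /eqP.
Qed.

Lemma clsub_opp x : I x -> I (- x).
Proof. by have [I0 IB _ _] := clsubP I => Ix; rewrite -sub0r; exact: IB. Qed.

Let sandwich u v w z : I u -> I v ->
  w + u /\_ v <= z -> z <= w + u \/_ v -> I (z - w).
Proof.
have [I0 IB IL IC] := clsubP I => Iu Iv h1 h2.
have [a b] := IL _ _ Iu Iv; apply: IC a b _ _; rewrite addrC.
  by rewrite -lg_addl_le.
by rewrite -lg_le_addl.
Qed.

Let bound x x' u : x - x' <= u -> x <= x' + u.
Proof. by move=> h; rewrite -(subrKC x' x) lg_le2l. Qed.
Let boundr x x' u : u <= x - x' -> x' + u <= x.
Proof. by move=> h; rewrite -(subrKC x' x) lg_le2l. Qed.

Lemma clsub_meet x x' y y' : I (x - x') -> I (y - y') ->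
  I (x /\_ y - x' /\_ y').
Proof.
move=> xI yI; apply: (sandwich xI yI); last rewrite addrC lg_meetD; rewrite lexI.
  apply/andP; split.
    exact: le_trans (lg_leD (leIl _ _) (leIl _ _)) (boundr (lexx _)).
  exact: le_trans (lg_leD (leIr _ _) (leIr _ _)) (boundr (lexx _)).
apply/andP; split; rewrite addrC.
  exact: le_trans (leIl _ _) (bound (leUl _ _)).
exact: le_trans (leIr _ _) (bound (leUr _ _)).
Qed.

Lemma clsub_join x x' y y' : I (x - x') -> I (y - y') ->
  I (x \/_ y - x' \/_ y').
Proof.
move=> xI yI; apply: (sandwich xI yI); first rewrite addrC lg_joinD; rewrite leUx.
  apply/andP; split; rewrite addrC.
    exact: le_trans (boundr (leIl _ _)) (leUl _ _).
  exact: le_trans (boundr (leIr _ _)) (leUr _ _).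
apply/andP; split.
  exact: le_trans (bound (lexx _)) (lg_leD (leUl _ _) (leUl _ _)).
exact: le_trans (bound (lexx _)) (lg_leD (leUr _ _) (leUr _ _)).
Qed.

Definition lquot_meet (a b : Q) : Q := \pi_Q (repr a /\_ repr b).
Definition lquot_join (a b : Q) : Q := \pi_Q (repr a \/_ repr b).

Let repr_pi x : I (repr (\pi_Q x) - x).
Proof. by apply/lquot_eqP; rewrite reprK. Qed.

Lemma lquot_meetE x y : lquot_meet (\pi_Q x) (\pi_Q y) = \pi_Q (x /\_ y).
Proof. by apply/lquot_eqP/clsub_meet. Qed.

Lemma lquot_joinE x y : lquot_join (\pi_Q x) (\pi_Q y) = \pi_Q (x \/_ y).
Proof. by apply/lquot_eqP/clsub_join. Qed.

Let ind (P : Q -> Prop) : (forall x, P (\pi_Q x)) -> forall a, P a.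
Proof. by move=> H a; rewrite -[a]reprK. Qed.

Let mC : commutative lquot_meet.
Proof. by elim/ind=> x; elim/ind=> y; rewrite !lquot_meetE meetC. Qed.
Let jC : commutative lquot_join.
Proof. by elim/ind=> x; elim/ind=> y; rewrite !lquot_joinE joinC. Qed.
Let mA : associative lquot_meet.
Proof.
by elim/ind=> x; elim/ind=> y; elim/ind=> z; rewrite !lquot_meetE meetA.
Qed.
Let jA : associative lquot_join.
Proof.
by elim/ind=> x; elim/ind=> y; elim/ind=> z; rewrite !lquot_joinE joinA.
Qed.
Let mK (x y : Q) : lquot_meet x (lquot_join x y) = x.
Proof.
by elim/ind: x => x; elim/ind: y => y; rewrite lquot_joinE lquot_meetE joinKI.
Qed.
Let jK (x y : Q) : lquot_join x (lquot_meet x y) = x.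
Proof.
by elim/ind: x => x; elim/ind: y => y; rewrite lquot_meetE lquot_joinE meetKU.
Qed.

Let Q_addP (x y z : Q) :
  ops_le lquot_meet x y -> ops_le lquot_meet (z + x) (z + y).
Proof.
elim/ind: x => x; elim/ind: y => y; elim/ind: z => z.
rewrite /ops_le lquot_meetE => /eqP/lquot_eqP xy.
rewrite -!raddfD lquot_meetE -lg_meetD; apply/eqP/lquot_eqP.
by rewrite opprD addrACA subrr add0r.
Qed.

(* The quotient G / I; the coset of x is at most that of y iff x <= y + i for some
   i in I, see [lquot_leE]. *)
Definition lquot : lgroupType := LGroupType
  (ops_le_refl mK jK) (ops_le_anti mC) (ops_le_trans mA)
  (ops_leI mC mA mK jK) (ops_leU mC jC jA mK jK) Q_addP.

Definition lquot_pi (x : G) : lquot := \pi_Q x.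

Lemma lquot_pi_surj (a : lquot) : exists x, lquot_pi x = a.
Proof. by exists (repr (a : Q)); exact: reprK. Qed.

Lemma lquot_piE x y : lquot_pi x = lquot_pi y <-> I (x - y).
Proof. exact: lquot_eqP. Qed.

Lemma lquot_piD x y : lquot_pi (x + y) = lquot_pi x + lquot_pi y.
Proof. exact: raddfD. Qed.

Lemma lquot_piB x y : lquot_pi (x - y) = lquot_pi x - lquot_pi y.
Proof. exact: raddfB. Qed.

Lemma lquot_pi0 : lquot_pi 0 = 0.
Proof. exact: raddf0. Qed.

Lemma lquot_piI x y : lquot_pi (x /\_ y) = lquot_pi x /\_ lquot_pi y.
Proof. exact/esym/lquot_meetE. Qed.

Lemma lquot_piU x y : lquot_pi (x \/_ y) = lquot_pi x \/_ lquot_pi y.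
Proof. exact/esym/lquot_joinE. Qed.

Lemma lquot_leE x y :
  lquot_pi x <= lquot_pi y <-> exists i, I i /\ x <= y + i.
Proof.
rewrite leEmeet -lquot_piI; split.
  move=> /eqP/lquot_piE/clsub_opp; rewrite opprB => xI.
  exists (x - x /\_ y); split=> //.
  by rewrite addrA addrAC -[leLHS]add0r lg_leD// -(subrr (x /\_ y)) lg_le2r leIr.
case=> i [Ii xyi]; have /lquot_piE yE : I (y + i - y) by rewrite addrAC subrr add0r.
by rewrite lquot_piI -yE -lquot_piI (meet_l xyi).
Qed.
End Quotient.

Definition at_most_two (d : Order.disp_t) (L : porderType d) (x y : L) : Prop :=
  ([set z : L | (x <= z <= y)%O] #<= `I_2)%card.

Section C1.
Variable G : lgroupType.
Implicit Types x y z u v a : G.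

Definition simple_chain x y : Prop := exists n (c : nat -> G),
  [/\ c 0%N = x, c n = y &
      forall i, (i < n)%N -> c i <= c i.+1 /\ at_most_two (c i) (c i.+1)].

Definition C1 : set G := [set a : G | simple_chain (a /\_ 0) (a \/_ 0)].

Lemma at_most_two_inj x y u v (f : G -> G) :
  (forall z, x <= z <= y -> u <= f z <= v) ->
  (forall z t, x <= z <= y -> x <= t <= y -> f z = f t -> z = t) ->
  at_most_two u v -> at_most_two x y.
Proof.
move=> fS fI; apply: card_le_trans.
have fI' : {in [set z : G | x <= z <= y] &, injective f}.
  by move=> z t /set_mem zP /set_mem tP; exact: fI.
rewrite -(card_le_eql (inj_card_eq fI')).
by apply: subset_card_le => _ [z zP <-]; exact: fS.
Qed.

Lemma simple_chain_refl x : simple_chain x x.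
Proof. by exists 0%N, (fun=> x); split. Qed.

Lemma simple_chain_trans x y z :
  simple_chain x y -> simple_chain y z -> simple_chain x z.
Proof.
move=> [n [c [c0 cn cS]]] [m [e [e0 em eS]]].
exists (n + m)%N, (fun i => if (i <= n)%N then c i else e (i - n)%N); split=> //.
- case: m em eS => [em _|m em eS]; last first.
    by rewrite leqNgt -addSnnS leq_addr /= addSnnS addnC addnK.
  by rewrite addn0 leqnn cn -e0 em.
- move=> i; case: (ltngtP i n) => [ni _|ni inm|-> inm]; first exact: cS.
    by rewrite subSn 1?ltnW//; apply: eS; rewrite ltn_subLR // ltnW.
  rewrite subSnn cn -e0; apply: eS.
  by rewrite -(ltn_add2l n) addn0.
Qed.

Lemma simple_chain_homo (f : G -> G) x y :
  (forall u v, u <= v -> at_most_two u v ->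
    f u <= f v /\ at_most_two (f u) (f v)) ->
  simple_chain x y -> simple_chain (f x) (f y).
Proof.
move=> fP [n [c [<- <- cS]]]; exists n, (f \o c); split=> // i /cS[].
exact: fP.
Qed.

Lemma simple_chain_add z x y : simple_chain x y -> simple_chain (z + x) (z + y).
Proof.
apply: (simple_chain_homo (f := fun t => z + t)) => u v uv uv2; split; first by rewrite lg_le2l.
apply: (at_most_two_inj (f := fun t => - z + t)) uv2 => [t|t s _ _ /addrI//].
by rewrite -lg_addl_le -lg_le_addl.
Qed.

Lemma simple_chain_meet z x y :
  simple_chain x y -> simple_chain (x /\_ z) (y /\_ z).
Proof.
apply: (simple_chain_homo (f := fun t => t /\_ z)) => u v uv uv2; split; first by rewrite leI2.
apply: (at_most_two_inj (f := fun t => t \/_ u)) uv2 => [t /andP[t1 t2]|t s].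
  by rewrite leUr leUx uv andbT (le_trans t2) ?leIl.
have H r : u /\_ z <= r <= v /\_ z -> r /\_ u = u /\_ z.
  move=> /andP[r1 r2]; apply/le_anti/andP; split; last by rewrite lexI r1 leIl.
  by rewrite lexI leIr (le_trans (leIl _ _)) // (le_trans r2) // leIr.
by move=> /H tu /H su; apply: lg_cancel; rewrite tu su.
Qed.

Lemma simple_chain_join z x y :
  simple_chain x y -> simple_chain (x \/_ z) (y \/_ z).
Proof.
apply: (simple_chain_homo (f := fun t => t \/_ z)) => u v uv uv2; split; first by rewrite leU2.
apply: (at_most_two_inj (f := fun t => t /\_ v)) uv2 => [t /andP[t1 t2]|t s].
  by rewrite leIr lexI uv !andbT (le_trans _ t1) ?leUl.
have H r : u \/_ z <= r <= v \/_ z -> r \/_ v = v \/_ z.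
  move=> /andP[r1 r2]; apply/le_anti/andP; split; first by rewrite leUx r2 leUl.
  by rewrite leUx leUr (le_trans _ (leUl _ _)) // (le_trans _ r1) // leUr.
by move=> /H tu /H su /lg_cancel; apply; rewrite tu su.
Qed.

Lemma simple_chain_sub x y u v :
  x <= u -> u <= v -> v <= y -> simple_chain x y -> simple_chain u v.
Proof.
move=> xu uv vy /(simple_chain_join u)/(simple_chain_meet v).
rewrite (join_r xu) (meet_l uv) (@join_l _ _ y) ?(le_trans uv) //.
by rewrite (meet_r vy).
Qed.

Lemma C1P a : C1 a <-> exists u v,
  [/\ u <= 0, 0 <= v, u <= a, a <= v & simple_chain u v].
Proof.
split=> [h|[u [v [u0 v0 ua av]]]].
  by exists (a /\_ 0), (a \/_ 0); rewrite leIl leIr leUl leUr.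
apply: simple_chain_sub; rewrite ?lexI ?leUx ?ua ?av//.
by rewrite (le_trans (leIl _ _)) ?leUl.
Qed.

Lemma C1_convex_lsubgroup : convex_lsubgroup C1.
Proof.
have C1S x y z : C1 x -> C1 y ->
    (forall u v u' v', u <= 0 -> 0 <= v -> u <= x -> x <= v -> u' <= 0 ->
       0 <= v' -> u' <= y -> y <= v' -> u + u' <= z /\ z <= v + v') -> C1 z.
  move=> /C1P[u [v [u0 v0 ux xv uv]]] /C1P[u' [v' [u0' v0' uy yv uv']]] /(_ u v u' v').
  case=> // z1 z2; apply/C1P; exists (u + u'), (v + v'); split=> //.
  - by rewrite -[leRHS]addr0 lg_leD.
  - by rewrite -[leLHS]addr0 lg_leD.
  apply: simple_chain_trans (simple_chain_add v uv').
  by rewrite ![_ + u']addrC; exact: simple_chain_add.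
split.
- by rewrite /C1/= meetxx joinxx; exact: simple_chain_refl.
- move=> x y Cx /C1P[u [v [u0 v0 uy yv uv]]].
  have CNy : C1 (- y).
    apply/C1P; exists (- v), (- u); split; rewrite ?lg_leN//.
    + by rewrite -oppr0 lg_leN.
    + by rewrite -oppr0 lg_leN.
    + have := simple_chain_add (- u - v) uv.
      by rewrite addrAC addNr add0r addrNK.
  apply: (C1S x (- y) _ Cx CNy) => a b a' b' _ _ ax xb _ _ ay yb.
  by split; exact: lg_leD.
- move=> x y Cx Cy; split; apply: (C1S x y _ Cx Cy) => u v u' v' u0 v0 ux xv u0' v0' uy yv.
  + split; last by rewrite -[leLHS]addr0 lg_leD // (le_trans (leIl _ _)).
    by rewrite lexI -[x]addr0 -[y]add0r !lg_leD.
  + split; first by rewrite -[leRHS]addr0 lg_leD // (le_trans _ (leUl _ _)).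
    by rewrite leUx -[x]addr0 -[y]add0r !lg_leD.
- move=> x y z Cx Cy xz zy; apply: (C1S x y _ Cx Cy) => u v u' v' u0 v0 ux xv u0' v0' uy yv.
  split; first by rewrite (le_trans _ xz) // -[leRHS]addr0 lg_leD.
  by rewrite (le_trans zy) // -[leLHS]add0r lg_leD.
Qed.

End C1.

Arguments C1 G : clear implicits.

Section Calpha.
Variable G : lgroupType.

(* C_(alpha+1) from C_alpha; the second branch is never reached along
   [C_seq], see [C_seq_convex]. *)
Definition C_succ (S : set G) : set G :=
  if pselect (convex_lsubgroup S) is left h
  then lquot_pi (Clsub h) @^-1` C1 (lquot (Clsub h))
  else setT.

Context {d : Order.disp_t} {W : ordType d}.

Definition C_seq : W -> set G :=
  trec [set 0 : G] C_succ (fun F => \bigcup_(S in F) S).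

Let C_seq_chain a : convex_lsubgroup (C_seq a) /\
  forall b, (b <= a)%O -> C_seq b `<=` C_seq a.
Proof.
apply: (@trec_chain _ _ _ _ _ _ (@convex_lsubgroup G) subset).
- by move=> S x.
- by move=> S T U ST TU x /ST/TU.
- split=> //=.
  + by move=> x y -> ->; rewrite subrr.
  + by move=> x y -> ->; rewrite meetxx joinxx.
  + by move=> x y z -> -> z0 z1; apply/le_anti/andP.
- move=> S hS; rewrite /C_succ; case: pselect => // h; set I := Clsub h.
  have [c0 cB cL cC] := C1_convex_lsubgroup (lquot I); split; last first.
    move=> x Sx /=; have -> : lquot_pi I x = lquot_pi I 0.
      by apply/lquot_piE; rewrite subr0.
    by rewrite lquot_pi0.
  split=> /=.
  + by rewrite lquot_pi0.
  + by move=> x y; rewrite lquot_piB; exact: cB.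
  + by move=> x y; rewrite lquot_piI lquot_piU; exact: cL.
  + move=> x y z Cx Cy xz zy; apply: (cC _ _ _ Cx Cy).
      by apply/lquot_leE; exists 0; rewrite addr0; split=> //; case: (h).
    by apply/lquot_leE; exists 0; rewrite addr0; split=> //; case: (h).
- move=> F [S0 FS0] FP Fch; split; last by move=> S FS x Sx; exists S.
  have F2 x y : (\bigcup_(S in F) S) x -> (\bigcup_(S in F) S) y ->
      exists S, [/\ F S, S x & S y].
    move=> [S FS Sx] [T FT Ty]; have [ST|TS] := Fch _ _ FS FT.
      by exists T; split=> //; exact: ST.
    by exists S; split=> //; exact: TS.
  split.
  + by exists S0 => //; case: (FP _ FS0).
  + move=> x y /F2/[apply] -[S [FS Sx Sy]]; exists S => //.
    by have [_ SB _ _] := FP _ FS; exact: SB.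
  + move=> x y /F2/[apply] -[S [FS Sx Sy]].
    have [_ _ /(_ _ _ Sx Sy)[S1 S2] _] := FP _ FS.
    by split; exists S.
  + move=> x y z /F2/[apply] -[S [FS Sx Sy]] xz zy; exists S => //.
    by have [_ _ _ SC] := FP _ FS; exact: SC xz zy.
Qed.

Lemma C_seq_convex a : convex_lsubgroup (C_seq a).
Proof. exact: (C_seq_chain a).1. Qed.

Definition C_ (a : W) : clsub G := Clsub (C_seq_convex a).

End Calpha.

Arguments C_seq G {d W}.
Arguments C_ G {d W}.

Definition congruence (d : Order.disp_t) (L : latticeType d)
    (R : L -> L -> Prop) : Prop :=
  [/\ (forall x, R x x), (forall x y, R x y -> R y x),
      (forall x y z, R x y -> R y z -> R x z) &
      (forall x x' y y', R x x' -> R y y' ->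
         R (x /\_ y) (x' /\_ y') /\ R (x \/_ y) (x' \/_ y'))].

Record congr_of (d : Order.disp_t) (L : latticeType d) := Congr {
  congr_rel :> L -> L -> Prop;
  congrP : congruence congr_rel
}.

Section LatticeQuotient.
Context {d : Order.disp_t} {L : tbLatticeType d} (R : congr_of L).
Implicit Types x y z : L.

Definition congr_bool : rel L := fun x y => `[< R x y >].

Lemma congr_equiv : equiv_class_of congr_bool.
Proof.
have [Rr Rs Rt _] := congrP R; split=> [x|x y|y x z].
- exact/asboolP.
- by apply/asboolP/asboolP; exact: Rs.
- by move=> /asboolP xy /asboolP yz; apply/asboolP/(Rt _ _ _ xy yz).
Qed.

Canonical congr_equiv_rel := EquivRelPack congr_equiv.

Definition latq : Type := {eq_quot congr_bool}.
HB.instance Definition _ := Choice.on latq.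

Let Q := {eq_quot congr_bool}.
Definition latq_pi x : latq := \pi_Q x.

Lemma latq_piE x y : latq_pi x = latq_pi y <-> R x y.
Proof.
by split=> [/eqmodP/asboolP //|Rxy]; apply/eqmodP/asboolP.
Qed.

Lemma latq_ind (P : latq -> Prop) : (forall x, P (latq_pi x)) -> forall a, P a.
Proof. by move=> H a; rewrite -[a](@reprK _ Q). Qed.

Definition latq_repr (a : latq) : L := repr (a : Q).
Definition latq_meet (a b : latq) := latq_pi (latq_repr a /\_ latq_repr b).
Definition latq_join (a b : latq) := latq_pi (latq_repr a \/_ latq_repr b).

Let repr_pi x : R (latq_repr (latq_pi x)) x.
Proof. by apply/latq_piE; rewrite /latq_repr /latq_pi reprK. Qed.

Lemma latq_meetE x y : latq_meet (latq_pi x) (latq_pi y) = latq_pi (x /\_ y).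
Proof.
apply/latq_piE; have [_ _ _ RL] := congrP R.
exact: (RL _ _ _ _ (repr_pi x) (repr_pi y)).1.
Qed.

Lemma latq_joinE x y : latq_join (latq_pi x) (latq_pi y) = latq_pi (x \/_ y).
Proof.
apply/latq_piE; have [_ _ _ RL] := congrP R.
exact: (RL _ _ _ _ (repr_pi x) (repr_pi y)).2.
Qed.

Let mC : commutative latq_meet.
Proof. by elim/latq_ind=> x; elim/latq_ind=> y; rewrite !latq_meetE meetC. Qed.
Let jC : commutative latq_join.
Proof. by elim/latq_ind=> x; elim/latq_ind=> y; rewrite !latq_joinE joinC. Qed.
Let mA : associative latq_meet.
Proof.
elim/latq_ind=> x; elim/latq_ind=> y; elim/latq_ind=> z.
by rewrite !latq_meetE meetA.
Qed.
Let jA : associative latq_join.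
Proof.
elim/latq_ind=> x; elim/latq_ind=> y; elim/latq_ind=> z.
by rewrite !latq_joinE joinA.
Qed.
Let mK (x y : latq) : latq_meet x (latq_join x y) = x.
Proof.
elim/latq_ind: x => x; elim/latq_ind: y => y.
by rewrite latq_joinE latq_meetE joinKI.
Qed.
Let jK (x y : latq) : latq_join x (latq_meet x y) = x.
Proof.
elim/latq_ind: x => x; elim/latq_ind: y => y.
by rewrite latq_meetE latq_joinE meetKU.
Qed.

HB.instance Definition _ := Order.Le_isPOrder.Build d latq
  (ops_le_refl mK jK) (ops_le_anti mC) (ops_le_trans mA).
HB.instance Definition _ := Order.POrder_MeetJoin_isLattice.Build d latq
  (ops_leI mC mA mK jK) (ops_leU mC jC jA mK jK).

Let le0 (a : latq) : (latq_pi \bot%O <= a)%O.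
Proof.
by elim/latq_ind: a => x; apply/eqP; rewrite latq_meetE meet0x.
Qed.
Let le1 (a : latq) : (a <= latq_pi \top%O)%O.
Proof.
by elim/latq_ind: a => x; apply/eqP; rewrite latq_meetE meetx1.
Qed.

HB.instance Definition _ := Order.hasBottom.Build d latq le0.
HB.instance Definition _ := Order.hasTop.Build d latq le1.

Lemma latq_piI x y : latq_pi (x /\_ y) = latq_pi x /\_ latq_pi y.
Proof. exact/esym/latq_meetE. Qed.

Lemma latq_piU x y : latq_pi (x \/_ y) = latq_pi x \/_ latq_pi y.
Proof. exact/esym/latq_joinE. Qed.

End LatticeQuotient.

Arguments latq {d L} R.
Arguments latq_pi {d L} R x.

Section MDimension.
Context {d : Order.disp_t}.

(* The smallest congruence identifying the endpoints of every interval with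
   at most two elements. *)
Definition simple_congr (L : latticeType d) (x y : L) : Prop :=
  forall R : L -> L -> Prop, congruence R ->
    (forall u v : L, (u <= v)%O -> at_most_two u v -> R u v) -> R x y.

Lemma simple_congr_congruence (L : latticeType d) :
  congruence (@simple_congr L).
Proof.
split=> [x R [RR _ _ _] _ //|x y h R cR Ri|x y z h k R cR Ri|x x' y y' h k].
- by have [_ Rs _ _] := cR; apply: Rs; exact: h.
- by have [_ _ Rt _] := cR; apply: (Rt _ y); [exact: h|exact: k].
- split=> R cR Ri; have [_ _ _ RL] := cR.
    exact: (RL _ _ _ _ (h R cR Ri) (k R cR Ri)).1.
  exact: (RL _ _ _ _ (h R cR Ri) (k R cR Ri)).2.
Qed.

Variable L : tbLatticeType d.

(* The kernel of L -> L_(alpha+1) from that of L -> L_alpha; the second branch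
   is never reached along [mdim_ker], see [mdim_ker_congruence]. *)
Definition mdim_ker_succ (R : L -> L -> Prop) : L -> L -> Prop :=
  if pselect (congruence R) is left h
  then fun x y => simple_congr (latq_pi (Congr h) x) (latq_pi (Congr h) y)
  else fun _ _ => True.

Context {d' : Order.disp_t} {W : ordType d'}.

Definition mdim_ker : W -> L -> L -> Prop :=
  trec (fun x y => x = y) mdim_ker_succ
    (fun F x y => exists2 R : L -> L -> Prop, F R & R x y).

Let mdim_ker_chain a : congruence (mdim_ker a) /\
  forall b, (b <= a)%O -> forall x y, mdim_ker b x y -> mdim_ker a x y.
Proof.
apply: (@trec_chain _ _ _ _ _ _ (@congruence d L)
  (fun R S => forall x y, R x y -> S x y)).
- by [].
- by move=> R S T RS ST x y /RS/ST.
- by split=> [//|x y ->|x y z -> ->|x x' y y' -> ->].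
- move=> R hR; rewrite /mdim_ker_succ; case: pselect => // h; set I := Congr h.
  have [sr ss st sL] := simple_congr_congruence (latq I); split; last first.
    move=> x y Rxy; have -> : latq_pi I x = latq_pi I y by exact/latq_piE.
    exact: sr.
  split=> [x|x y|x y z|x x' y y' h1 h2]; [exact: sr|exact: ss|exact: st|].
  by rewrite !latq_piI !latq_piU; exact: sL.
- move=> F [R0 FR0] FP Fch; split; last by move=> R FR x y Rxy; exists R.
  have F2 x y x' y' : (exists2 R : L -> L -> Prop, F R & R x y) ->
      (exists2 R : L -> L -> Prop, F R & R x' y') ->
      exists R, [/\ F R, R x y & R x' y'].
    move=> [S FS Sx] [T FT Ty]; have [ST|TS] := Fch _ _ FS FT.
      by exists T; split=> //; exact: ST.
    by exists S; split=> //; exact: TS.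
  split.
  + by move=> x; exists R0 => //; case: (FP _ FR0).
  + by move=> x y [R FR Rxy]; exists R => //; have [_ Rs _ _] := FP _ FR; exact: Rs.
  + move=> x y z /F2/[apply] -[R [FR Rxy Ryz]]; exists R => //.
    by have [_ _ Rt _] := FP _ FR; exact: Rt Ryz.
  + move=> x x' y y' /F2/[apply] -[R [FR Rxx' Ryy']].
    have [_ _ _ /(_ _ _ _ _ Rxx' Ryy')[R1 R2]] := FP _ FR.
    by split; exists R.
Qed.

Lemma mdim_ker_congruence a : congruence (mdim_ker a).
Proof. exact: (mdim_ker_chain a).1. Qed.

(* The lattice L_alpha. *)
Definition mdim_quot (a : W) : tbLatticeType d :=
  latq (Congr (mdim_ker_congruence a)).

Definition one_point (T : Type) : Prop := exists t : T, forall s, s = t.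

(* The m-dimension is the predecessor b of the least a with L_a a point. *)
Definition has_mdim (b : W) : Prop :=
  (exists x y : L, x <> y) /\
  exists a : W, [/\ is_succ b a, one_point (mdim_quot a) &
    forall c : W, one_point (mdim_quot c) -> (a <= c)%O].

End MDimension.

Arguments mdim_quot {d} L {d' W}.
Arguments has_mdim {d} L {d' W}.

(* [None] is the new top element. *)
Section PosInf.
Variable G : lgroupType.

Definition posinf : Type := option {x : G | 0 <= x}.
HB.instance Definition _ := Choice.on posinf.

Definition posinf_le (u v : posinf) : bool :=
  match u, v with
  | _, None => true
  | None, Some _ => false
  | Some a, Some b => val a <= val b
  end.

Let meet_ge0 (a b : {x : G | 0 <= x}) : 0 <= val a /\_ val b.
Proof. by rewrite lexI (valP a) (valP b). Qed.
Let join_ge0 (a b : {x : G | 0 <= x}) : 0 <= val a \/_ val b.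
Proof. by rewrite (le_trans (valP a)) ?leUl. Qed.

Definition posinf_meet (u v : posinf) : posinf :=
  match u, v with
  | None, w | w, None => w
  | Some a, Some b => Some (exist _ (val a /\_ val b) (meet_ge0 a b))
  end.

Definition posinf_join (u v : posinf) : posinf :=
  match u, v with
  | Some a, Some b => Some (exist _ (val a \/_ val b) (join_ge0 a b))
  | _, _ => None
  end.

Let le_refl : reflexive posinf_le.
Proof. by case=> [a|] /=. Qed.
Let le_anti : antisymmetric posinf_le.
Proof. by move=> [a|] [b|] //= /le_anti/val_inj ->. Qed.
Let le_trans : transitive posinf_le.
Proof. by move=> [b|] [a|] [c|] //=; exact: le_trans. Qed.
Let meetP x y z : posinf_le x (posinf_meet y z) = posinf_le x y && posinf_le x z.
Proof. by case: x y z => [a|] [b|] [c|] //=; rewrite ?lexI ?andbT ?andbF. Qed.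
Let joinP x y z : posinf_le (posinf_join x y) z = posinf_le x z && posinf_le y z.
Proof. by case: x y z => [a|] [b|] [c|] //=; rewrite ?leUx ?andbT ?andbF. Qed.

HB.instance Definition _ :=
  Order.Le_isPOrder.Build ring_display posinf le_refl le_anti le_trans.
HB.instance Definition _ :=
  Order.POrder_MeetJoin_isLattice.Build ring_display posinf meetP joinP.

Let le0 (u : posinf) : ((Some (exist _ 0 (lexx (0 : G))) : posinf) <= u)%O.
Proof. by case: u => // -[a a0]. Qed.
Let le1 (u : posinf) : (u <= (None : posinf))%O.
Proof. by case: u. Qed.

HB.instance Definition _ := Order.hasBottom.Build ring_display posinf le0.
HB.instance Definition _ := Order.hasTop.Build ring_display posinf le1.

Let meetUl :
  left_distributive (@Order.meet _ posinf) (@Order.join _ posinf).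
Proof.
move=> [b|] [c|] [a|] //=; rewrite /Order.meet /Order.join /=; congr Some;
  apply/val_inj => /=.
- by rewrite lg_meetUl.
- by rewrite joinC [sval b /\_ _]meetC meetKU.
- by rewrite [sval c /\_ _]meetC meetKU.
- by rewrite joinxx.
Qed.

HB.instance Definition _ :=
  Order.Lattice_Meet_isDistrLattice.Build ring_display posinf meetUl.

End PosInf.

Section CZ.
Variable X : topologicalType.

Definition CZ_carrier : Type := continuousType X (discrete_topology int).
HB.instance Definition _ := Choice.on CZ_carrier.

Definition CZ_val (f : CZ_carrier) : X -> int := f.

Lemma CZ_ext (f g : CZ_carrier) : CZ_val f =1 CZ_val g -> f = g.
Proof. by move=> fg; apply/continuousEP. Qed.

Lemma CZ_near (f : CZ_carrier) (x : X) : \forall y \near x, CZ_val f y = CZ_val f x.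
Proof.
pose f' : continuousType X (discrete_topology int) := f.
exact: (@cts_fun _ _ f' x [set f' x] (discrete_set1 (f' x))).
Qed.

Lemma CZ_cont (h : X -> int) :
  (forall x, \forall y \near x, h y = h x) ->
  continuous (h : X -> discrete_topology int).
Proof.
move=> hP x A /nbhs_singleton Ahx; apply: filterS (hP x) => y /= ->; exact: Ahx.
Qed.

Let op2_cont (op : int -> int -> int) (f g : CZ_carrier) :
  continuous ((fun x => op (CZ_val f x) (CZ_val g x)) : X -> discrete_topology int).
Proof.
by apply: CZ_cont => x; near=> y; congr op; near: y; exact: CZ_near.
Unshelve. all: by end_near.
Qed.

Definition CZ_op (op : int -> int -> int) (f g : CZ_carrier) : CZ_carrier :=
  mkcts (@op2_cont op f g).

Definition CZ_zero : CZ_carrier := (cst (0 : int) : X -> discrete_topology int).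
Definition CZ_add := CZ_op +%R.
Definition CZ_opp (f : CZ_carrier) := CZ_op (fun _ m => - m) f f.
Definition CZ_meet := CZ_op Num.min.
Definition CZ_join := CZ_op Num.max.
Definition CZ_le (f g : CZ_carrier) : bool := `[< forall x, CZ_val f x <= CZ_val g x >].

Let addA : associative CZ_add.
Proof. by move=> f g h; apply: CZ_ext => x; exact: addrA. Qed.
Let addC : commutative CZ_add.
Proof. by move=> f g; apply: CZ_ext => x; exact: addrC. Qed.
Let add0 : left_id CZ_zero CZ_add.
Proof. by move=> f; apply: CZ_ext => x; exact: add0r. Qed.
Let addN : left_inverse CZ_zero CZ_opp CZ_add.
Proof. by move=> f; apply: CZ_ext => x; exact: addNr. Qed.

HB.instance Definition _ := GRing.isZmodule.Build CZ_carrier addA addC add0 addN.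

Let le_refl : reflexive CZ_le.
Proof. by move=> f; apply/asboolP. Qed.
Let le_anti : antisymmetric CZ_le.
Proof.
move=> f g /andP[/asboolP fg /asboolP gf]; apply: CZ_ext => x.
by apply/le_anti; rewrite fg gf.
Qed.
Let le_trans : transitive CZ_le.
Proof.
move=> g f h /asboolP fg /asboolP gh; apply/asboolP => x.
exact: le_trans (fg x) (gh x).
Qed.
Let meetP f g h : CZ_le f (CZ_meet g h) = CZ_le f g && CZ_le f h.
Proof.
apply/asboolP/andP => [H|[/asboolP fg /asboolP fh] x]; last first.
  by rewrite /CZ_val /= le_min; apply/andP; split; [exact: fg|exact: fh].
split; apply/asboolP => x; have := H x; rewrite /CZ_val /= le_min => /andP[] //.
Qed.
Let joinP f g h : CZ_le (CZ_join f g) h = CZ_le f h && CZ_le g h.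
Proof.
apply/asboolP/andP => [H|[/asboolP fh /asboolP gh] x]; last first.
  by rewrite /CZ_val /= ge_max; apply/andP; split; [exact: fh|exact: gh].
split; apply/asboolP => x; have := H x; rewrite /CZ_val /= ge_max => /andP[] //.
Qed.
Let addP (f g h : CZ_carrier) : CZ_le f g -> CZ_le (h + f) (h + g).
Proof. by move=> /asboolP fg; apply/asboolP => x; exact: lerD (lexx _) (fg x). Qed.

Definition CZ : lgroupType :=
  LGroupType le_refl le_anti le_trans meetP joinP addP.

End CZ.

(* Main.v *)
Require Import Defs.
From mathcomp Require Import all_boot all_order all_algebra.
From mathcomp Require Import all_classical topology.

(** Write [Z(K)] for the group of continuous integer-valued functions vanishing on a
    set [K].  Everything follows from the equality [C_a = Z(X^(a))], proved by
    transfinite induction ([C_seq_vanishing]).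

    Suppose that it holds at [a] and put [K = X^(a)].  Then [G/C_a] consists of
    the restrictions of functions to [K], with pointwise order.  An interval [[f, g]]
    of restrictions with at most two elements cannot have [f <> g] at a non-isolated
    point [x] of [K]: gluing [g] near [x] with [f] elsewhere, along a clopen set that
    separates [x] from a nearby point of [K], gives a third element.  So an element of
    [C_(a+1)] vanishes at the non-isolated points of [K] ([vanishing_of_C1]).
    Conversely the indicator of an isolated point of [K] is an atom, and a function
    supported on isolated points of [K] is by compactness a finite integral
    combination of such indicators ([C1_of_vanishing]).  At a limit, a function
    vanishing on the decreasing intersection of the closed sets [X^(b)] has a clopen
    zero set, which contains some [X^(b)] by compactness.  The first claim is now that
    restriction to a closed set [K] is surjective with kernel [Z(K)]
    ([restriction_iso]): a function on [K] is locally the restriction of a constant,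
    and finitely many constants are glued along clopen sets.

    The second claim rests on a fact about every l-group [G]: as long as the groups
    [C_c] for [c < a] are proper, the kernel of [L -> L_a], for [L] the positive cone
    with an infinity added, identifies infinity with itself only, and two finite
    elements when their difference is in [C_a] ([mdim_kerE]).  Intervals of [L_c]
    between finite elements are intervals of [G/C_c], so the finite parts of both
    constructions agree, and an interval from a finite element up to infinity is
    infinite while [G/C_c] is not zero.  Hence when [b] is least with [C_b = G], the
    lattice [L_b] is a chain with two elements and the next one is a point, so the
    m-dimension is [b] ([has_mdim_lgroup]).  By compactness a Boolean space of rank
    [b] has non-empty [X^(b)] ([CB_rank_attained]), so the least such index for
    [C(X, Z)] is [b + 1]. *)

Set Implicit Arguments.
Unset Strict Implicit.
Unset Printing Implicit Defensive.

Import Order.TTheory GRing.Theory Num.Theory.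

Local Open Scope classical_set_scope.
Local Open Scope ring_scope.

Local Notation "x /\_ y" := (Order.meet x y) (at level 40, left associativity).
Local Notation "x \/_ y" := (Order.join x y) (at level 40, left associativity).

(** * Clopen sets in Boolean spaces *)

Section BooleanSpaces.
Variable X : topologicalType.
Implicit Types (K U V D : set X) (P : set X -> Prop) (x y : X).

(** Compactness as an induction principle: sets satisfying [P] are closed under
    finite unions, so [P] passes from small open sets to a neighbourhood of [K].
    The arguments by finite subcovers below are instances. *)
Lemma compact_ind K P : compact K -> P set0 ->
  (forall U V, P U -> P V -> P (U `|` V)) ->
  (forall x, K x -> exists U, [/\ open U, U x & P U]) ->
  exists U, K `<=` U /\ P U.
Proof.
move=> cK P0 PU Px.
(* The sets satisfying P are directed by inclusion; K is eventually covered. *)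
pose F : set_system (set X) :=
  filter_from P (fun U => [set V | P V /\ U `<=` V]).
have FF : Filter F.
  apply: filter_from_filter; first by exists set0.
  move=> U V PU' PV; exists (U `|` V); first exact: PU.
  by move=> W [PW UVW]; split; split=> //;
    apply: subset_trans UVW; [exact: subsetUl|exact: subsetUr].
have /(iffLR (compact_near_coveringP _))/(_ _ F (fun U => U) FF) := cK.
case=> [x Kx|U PU' H].
  have [U [oU Ux PU']] := Px x Kx.
  exists (U, [set V | P V /\ U `<=` V]); first split.
  - exact: open_nbhs_nbhs.
  - by exists U.
  - by case=> y V [/= Uy [_]]; apply.
by exists U; split=> //; exact: (H U (conj PU' (@subset_refl _ U))).
Qed.

(** In a compact Hausdorff space the intersection [Q] of all clopen sets containing
    a point is connected: if [Q] splits into disjoint closed sets, normality separates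
    them by disjoint open sets, and by compactness one clopen set around the point is
    already covered by these two.  Total disconnectedness then reduces [Q] to the
    point. *)
Lemma boolean_zero_dimensional : boolean_space X -> zero_dimensional X.
Proof.
case=> hX cX tX x y xy; apply: contrapT => nU.
pose Q := [set z | forall D, clopen D -> D x -> D z].
have cQ : closed Q.
  have -> : Q = \bigcap_(D in [set D | clopen D /\ D x]) D.
    by apply/seteqP; split=> z Qz D => [[]|]; [exact: Qz|move=> cD Dx; exact: Qz].
  by apply: closed_bigI => D [[]].
have Qx : Q x by [].
(* A closed piece A of Q containing x whose complement B in Q is closed is cut
   out of Q by a clopen set. *)
have Qconn A B : closed A -> closed B -> A `&` B = set0 -> A `|` B = Q -> A x ->
    B = set0.
  move=> cA cB AB0 ABQ Ax.
  have nB : set_nbhs A (~` B).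
    apply/set_nbhsP; exists (~` B); split=> //; first exact: closed_openC.
    by apply/disjoints_subset.
  have [V nV VB] := compact_normal hX cX cA nB.
  have [O [oO AO OV]] := (set_nbhsP _ _).1 nV.
  pose K := ~` O `&` closure V.
  have cK : compact K.
    apply: (subclosed_compact _ cX) => //; apply: closedI; first exact: open_closedC.
    exact: closed_closure.
  have [||z [nOz Vz]|U [KU [D [cD Dx DU]]]] :=
      @compact_ind K (fun U => exists D, [/\ clopen D, D x & D `&` U = set0]) cK.
  - by exists setT; split=> //; [exact: clopenT|rewrite setI0].
  - move=> U W [D [cD Dx DU]] [E [cE Ex EW]]; exists (D `&` E); split=> //.
      exact: clopenI.
    rewrite setIUr setIAC DU set0I set0U -setIA EW setI0 //.
  - have : ~ Q z.
      by rewrite -ABQ => -[/AO//|]; exact: VB.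
    move=> /existsNP[D /not_implyP[cD /not_implyP[Dx Dz]]].
    exists (~` D); split=> //; first by apply: closed_openC; case: cD.
    by exists D; split=> //; rewrite setICr.
  have DO : D `&` O = D `&` closure V.
    apply/seteqP; split=> z [Dz] => [/OV/subset_closure//|Vz]; split=> //.
    apply: contrapT => nOz; have : (D `&` U) z by split=> //; apply: KU.
    by rewrite DU.
  have cDO : clopen (D `&` O).
    split; first by apply: openI => //; case: cD.
    by rewrite DO; apply: closedI; [case: cD|exact: closed_closure].
  apply/seteqP; split=> // z Bz.
  have Qz : Q z by rewrite -ABQ; right.
  have [_ Oz] := Qz _ cDO (conj Dx (AO _ Ax)).
  exact: VB (subset_closure (OV _ Oz)) Bz.
have Qc : connected Q.
  move=> A [a Aa] [O oO AO] [C cC AC].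
  have cA : closed A by rewrite AC; exact: closedI.
  have cB : closed (Q `&` ~` O) by apply: closedI => //; exact: open_closedC.
  have AB0 : A `&` (Q `&` ~` O) = set0 by rewrite AO setIACA setIid setICr setI0.
  have ABQ : A `|` (Q `&` ~` O) = Q by rewrite AO -setIUr setUCr setIT.
  have [Ax|nAx] := pselect (A x).
    by rewrite -[RHS]ABQ (Qconn _ _ cA cB AB0 ABQ Ax) setU0.
  have /(_ _) A0 := Qconn _ _ cB cA.
  suff : A = set0 by move=> A00; move: Aa; rewrite A00.
  by apply: A0; [rewrite setIC|rewrite setUC|rewrite -ABQ in Qx; case: Qx].
have Qy : Q y.
  move=> D cD Dx; apply: contrapT => nDy; apply: nU; by exists D; split.
have : connected_component [set: X] x y by apply: (connected_component_max _ _ Qc).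
by rewrite tX // => yx; rewrite yx eqxx in xy.
Qed.

Lemma clopen_nbhs x U : boolean_space X -> nbhs x U ->
  exists D, [/\ clopen D, D x & D `<=` U].
Proof.
move=> bX Ux; have [hX cX _] := bX.
have /(_ U Ux)[D [Dx cD] DU] :=
  @zero_dimensional_cvg _ x hX (boolean_zero_dimensional bX) cX.
by exists D.
Qed.

End BooleanSpaces.

(** * Intervals with at most two elements *)

(** The cardinality condition in usable form: an interval with distinct endpoints has
    at most two elements when nothing lies strictly between them. *)
Lemma at_most_twoP (d : Order.disp_t) (L : porderType d) (x y : L) :
  (x <= y)%O ->
  at_most_two x y <-> forall z, (x <= z)%O -> (z <= y)%O -> z = x \/ z = y.
Proof.
move=> xy; split=> [xy2 z xz zy|H].
- apply: contrapT => /not_orP[zx zy'].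
  have [xy'|xny] := eqVneq x y.
    by apply: zx; apply/le_anti; rewrite xz xy' zy.
  pose c i := nth x [:: x; z; y] i.
  have cI : set_inj `I_3 c.
    move=> i j /set_mem/= i3 /set_mem/= j3 /eqP.
    rewrite nth_uniq // => [/eqP//|].
    rewrite /= !inE !andbT !negb_or xny andbT.
    by apply/andP; split; apply/eqP => // zx'; exact: zx.
  suff : (`I_3 #<= `I_2)%card by rewrite card_le_II.
  apply: card_le_trans xy2; rewrite -(card_le_eql (inj_card_eq cI)).
  apply: subset_card_le => _ [[|[|[|//]]] _ <-] /=.
  + by rewrite /c /= lexx.
  + by rewrite /c /= xz.
  + by rewrite /c /= lexx andbT.
- pose c z := nat_of_bool (z != x).
  have cI : set_inj [set z | (x <= z <= y)%O] c.
    move=> z t /set_mem/= /andP[xz zy] /set_mem/= /andP[xt ty].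
    rewrite /c; have [->|zx] := eqVneq z x; have [->//|tx] := eqVneq t x => // _.
    by have [/eqP|->] := H z xz zy; [rewrite (negPf zx)|
      have [/eqP|->//] := H t xt ty; rewrite (negPf tx)].
  rewrite /at_most_two -(card_le_eql (inj_card_eq cI)).
  by apply: subset_card_le => _ [z _ <-]; rewrite /c /=; case: (_ == _).
Qed.

Lemma at_most_two_chain (G : lgroupType) (x y : G) :
  x <= y -> at_most_two x y -> simple_chain x y.
Proof.
by move=> xy xy2; exists 1%N, (fun i => if i is 0 then x else y); split=> // -[].
Qed.

Section LgroupQuotients.
Variables (G : lgroupType) (I : clsub G).
Implicit Types x y : G.

Lemma lquot_le_meet x y : lquot_pi I x <= lquot_pi I y <-> I (x /\_ y - x).
Proof.
rewrite leEmeet -lquot_piI; split=> [/eqP/lquot_piE//|/lquot_piE/eqP//].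
Qed.

(** The case distinction in [C_succ] is always decided by [clsubP]. *)
Lemma C_succE x : C_succ I x <-> C1 (lquot I) (lquot_pi I x).
Proof.
rewrite /C_succ; case: pselect => [h|/(_ (clsubP I))//].
have -> // : Clsub h = I by case: I h => S hS h; congr Clsub; exact: Prop_irrelevance.
Qed.

End LgroupQuotients.

(** * Continuous integer-valued functions *)

Section IntegerFunctions.
Variable X : topologicalType.
Implicit Types (f g : CZ X) (K U : set X) (x : X).

Definition vanishing K : set (CZ X) := [set f | forall x, K x -> CZ_val f x = 0].

Lemma CZ_clopen f (A : set int) : clopen [set x | A (CZ_val f x)].
Proof.
have oA (B : set int) : open [set x | B (CZ_val f x)].
  by rewrite openE => x /= Bx; near=> y; rewrite /=; suff -> : CZ_val f y = CZ_val f x by [];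
    near: y; exact: CZ_near.
split; first exact: oA.
by rewrite -[X in closed X]setCK; apply: open_closedC; exact: (oA (~` A)).
Unshelve. all: by end_near. Qed.

(** Any two functions can be glued along a clopen set, with no compatibility condition
    on the boundary. *)
Lemma CZ_patch U f g : clopen U -> exists h : CZ X,
  (forall x, U x -> CZ_val h x = CZ_val f x) /\
  (forall x, ~ U x -> CZ_val h x = CZ_val g x).
Proof.
move=> [oU cU]; pose h x := if x \in U then CZ_val f x else CZ_val g x.
have hE x : h x = if x \in U then CZ_val f x else CZ_val g x by [].
have hc : continuous (h : X -> discrete_topology int).
  apply: CZ_cont => x; have [Ux|nUx] := pselect (U x).
    near=> y; rewrite !hE (mem_set Ux) mem_set; last first.
      by near: y; exact: open_nbhs_nbhs.
    by near: y; exact: CZ_near.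
  near=> y; rewrite !hE (memNset nUx) memNset; last first.
    near: y; apply: (@open_nbhs_nbhs _ x (~` U)); split=> //; exact: closed_openC.
  by near: y; exact: CZ_near.
exists (mkcts hc : continuousType X (discrete_topology int)); split=> x Ux.
  by rewrite /CZ_val /= /mkcts hE mem_set.
by rewrite /CZ_val /= /mkcts hE memNset.
Unshelve. all: by end_near. Qed.

Lemma CZ_cst (n : int) : exists h : CZ X, forall x, CZ_val h x = n.
Proof.
by exists ((cst n : X -> discrete_topology int) : continuousType X (discrete_topology int)).
Qed.

Lemma CZ_valE f g x :
  [/\ CZ_val (f + g) x = CZ_val f x + CZ_val g x,
      CZ_val (f - g) x = CZ_val f x - CZ_val g x,
      CZ_val (f /\_ g) x = Num.min (CZ_val f x) (CZ_val g x) &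
      CZ_val (f \/_ g) x = Num.max (CZ_val f x) (CZ_val g x)].
Proof. by []. Qed.

End IntegerFunctions.

(** * Cantor-Bendixson derivatives *)

Section CBDerivative.
Context (X : topologicalType) {d : Order.disp_t} {W : ordType d}.
Implicit Types (a b : W) (K : set X).

Lemma closed_setD_isolated K : closed K -> closed (K `\` isolated K).
Proof.
move=> cK; rewrite -[X in closed X]setCK; apply: open_closedC.
rewrite openE => x /= nx.
have [Kx|nKx] := pselect (K x); last first.
  suff : nbhs x (~` K) by apply: filterS => y nKy [].
  by apply: open_nbhs_nbhs; split=> //; exact: closed_openC.
have : isolated K x by apply: contrapT => ix; apply: nx.
move=> [_ [V Vx VK]]; apply: filterS (Vx) => y Vy [Ky iy]; apply: iy.
have : (V `&` K) y by [].
rewrite VK => /= yx; rewrite yx; split; first exact: mem_set.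
by exists V.
Qed.

Lemma CB_chain a : closed (CB_derivative X a) /\
  forall b, (b <= a)%O -> CB_derivative X a `<=` CB_derivative X b.
Proof.
apply: (@trec_chain _ _ _ _ _ _ (@closed X) (fun A B => B `<=` A)).
- by move=> A x.
- by move=> A B C AB BC; exact: subset_trans BC AB.
- exact: closedT.
- by move=> K cK; split; [exact: closed_setD_isolated|exact: subDsetl].
- move=> F F0 Fc _; split; first by apply: closed_bigI.
  by move=> K FK; exact: bigcap_inf.
Qed.

Lemma closed_CB a : closed (CB_derivative X a).
Proof. exact: (CB_chain a).1. Qed.

Lemma CB_le a b : (b <= a)%O -> CB_derivative X a `<=` CB_derivative X b.
Proof. exact: (CB_chain a).2. Qed.

End CBDerivative.

(** * The groups C_alpha are the groups of functions vanishing on a derivative *)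

Section CantorBendixsonCalpha.
Variable X : topologicalType.
Hypothesis bX : boolean_space X.
Implicit Types (f g : CZ X) (K U V : set X) (x y : X).

Lemma closed_compactX K : closed K -> compact K.
Proof. by case: bX => _ cX _ cK; exact: subclosed_compact cX _. Qed.

Section OneStep.
Variables (K : set X) (I : clsub (CZ X)).
Hypotheses (cK : closed K) (IK : clsub_set I = vanishing K).

Lemma lquot_vanishing_le f g :
  lquot_pi I f <= lquot_pi I g <-> forall x, K x -> CZ_val f x <= CZ_val g x.
Proof.
have fgE x : CZ_val (f /\_ g - f) x = Num.min (CZ_val f x) (CZ_val g x) - CZ_val f x by [].
split=> [/lquot_le_meet|fg].
  rewrite IK => fg x /fg; rewrite fgE => /eqP; rewrite subr_eq0 => /eqP<-.
  by rewrite ge_min lexx orbT.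
apply/lquot_le_meet; rewrite IK => x /fg fgx.
by rewrite fgE min_l // subrr.
Qed.

Lemma lquot_vanishing_eq f g :
  lquot_pi I f = lquot_pi I g <-> forall x, K x -> CZ_val f x = CZ_val g x.
Proof.
have fgE x : CZ_val (f - g) x = CZ_val f x - CZ_val g x by [].
split=> [/lquot_piE|fg]; last apply/lquot_piE.
  by rewrite IK => fg x /fg; rewrite fgE => /eqP; rewrite subr_eq0 => /eqP.
by rewrite IK => x /fg fgx; rewrite fgE fgx subrr.
Qed.

(** If [f] and [g] differ at a non-isolated point [x] of [K], let [D] be the clopen set
    where both keep their value at [x]; it contains another point [y] of [K].  Gluing
    [g] on a clopen set containing [x] but not [y] with [f] outside gives an element of
    the interval different from [f] at [x] and from [g] at [y]. *)
Lemma simple_interval_isolated f g x :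
  lquot_pi I f <= lquot_pi I g -> at_most_two (lquot_pi I f) (lquot_pi I g) ->
  K x -> ~ isolated K x -> CZ_val f x = CZ_val g x.
Proof.
move=> fg /(at_most_twoP fg) H Kx nix; apply: contrapT => fgx.
move/lquot_vanishing_le: fg => fg.
apply: nix; split; first exact: mem_set.
pose D := [set y | CZ_val f y = CZ_val f x] `&` [set y | CZ_val g y = CZ_val g x].
have Dx : D x by [].
have nD : nbhs x D.
  have [oD _] : clopen D.
    by apply: clopenI; apply: (CZ_clopen _ [set n | n = _]).
  exact: open_nbhs_nbhs.
exists D => //; apply/seteqP; split=> [y [Dy Ky]|_ ->//].
apply: contrapT => /eqP yx; have zd := boolean_zero_dimensional bX.
have [U [cU Ux nUy]] : exists U, [/\ clopen U, U x & ~ U y].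
  by apply: zd; rewrite eq_sym.
have [h [hU hnU]] := CZ_patch g f cU.
have [] := H (lquot_pi I h).
- apply/lquot_vanishing_le => z Kz.
  by have [Uz|nUz] := pselect (U z); [rewrite hU//; exact: fg|rewrite hnU].
- apply/lquot_vanishing_le => z Kz.
  by have [Uz|nUz] := pselect (U z); [rewrite hU|rewrite hnU//; exact: fg].
- by move/lquot_vanishing_eq => /(_ x Kx); rewrite hU // => /esym.
- move/lquot_vanishing_eq => /(_ y Ky); rewrite hnU //.
  by case: Dy => /= -> ->.
Qed.

Lemma simple_chain_isolated f g x :
  simple_chain (lquot_pi I f) (lquot_pi I g) ->
  K x -> ~ isolated K x -> CZ_val f x = CZ_val g x.
Proof.
move=> [n [c [c0 cn cS]]] Kx nix.
have : forall i, (i <= n)%N -> forall h, lquot_pi I h = c i -> CZ_val f x = CZ_val h x.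
  elim=> [|i IH] ni h hi.
    by move: (hi); rewrite c0 => /lquot_vanishing_eq /(_ x Kx).
  have [k ki] := lquot_pi_surj (c i).
  rewrite (IH (ltnW ni) k ki); have [] := cS i ni; rewrite -ki -hi => le2 two.
  exact: simple_interval_isolated le2 two Kx nix.
by apply; [exact: leqnn|].
Qed.

Lemma vanishing_of_C1 f :
  C1 (lquot I) (lquot_pi I f) -> vanishing (K `\` isolated K) f.
Proof.
rewrite /C1 /= -(lquot_pi0 I) -lquot_piI -lquot_piU => ch x [Kx nix].
have := simple_chain_isolated ch Kx nix.
have [_ _ -> ->] := CZ_valE f 0 x.
have -> : CZ_val (0 : CZ X) x = 0 by [].
by case: (leP (CZ_val f x) 0) => // _ <-.
Qed.

(** On [K] such a function is the indicator of a point, hence an atom of the quotient,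
    or it is zero there if the point lies outside [K]. *)
Lemma C1_indicator (h : CZ X) x :
  (forall y, K y -> y <> x -> CZ_val h y = 0) -> CZ_val h x = 1 ->
  C1 (lquot I) (lquot_pi I h).
Proof.
move=> h0 h1; have h01 : lquot_pi I 0 <= lquot_pi I h.
  apply/lquot_vanishing_le => y Ky; have -> : CZ_val (0 : CZ X) y = 0 by [].
  by have [->|/eqP yx] := eqVneq y x; [rewrite h1|rewrite h0].
rewrite /C1 /= -(lquot_pi0 I) (meet_r h01) (join_l h01).
apply: at_most_two_chain => //; apply/(at_most_twoP h01) => c.
have [k <-] := lquot_pi_surj c => /lquot_vanishing_le k0 /lquot_vanishing_le k1.
have kE y : K y -> y <> x -> CZ_val k y = 0.
  move=> Ky yx; apply/le_anti; rewrite [X in _ && X](k0 y Ky) andbT.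
  by rewrite -(h0 y Ky yx); exact: k1.
have [Kx|nKx] := pselect (K x); last first.
  left; apply/lquot_vanishing_eq => y Ky; rewrite kE // => yx.
  by rewrite -yx in nKx.
have kx : CZ_val k x = 0 \/ CZ_val k x = 1.
  have : 0 <= CZ_val k x <= 1 by apply/andP; split; [exact: k0|rewrite -h1; exact: k1].
  case: (CZ_val k x) => [[|[|n]]|n] //; by [left|right].
case: kx => kx; [left|right]; apply/lquot_vanishing_eq => y Ky.
  by have [->|/eqP yx] := eqVneq y x; [rewrite kx|rewrite kE].
by have [->|/eqP yx] := eqVneq y x; [rewrite kx h1|rewrite kE // h0].
Qed.

Lemma C1_D (u v : lquot I) : C1 _ u -> C1 _ v -> C1 _ (u + v).
Proof.
have [c0 cB _ _] := C1_convex_lsubgroup (lquot I) => Cu Cv.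
by rewrite -[v]opprK; apply: (cB) => //; rewrite -sub0r; exact: cB.
Qed.

Lemma C1_N (u : lquot I) : C1 _ u -> C1 _ (- u).
Proof.
by have [c0 cB _ _] := C1_convex_lsubgroup (lquot I) => Cu; rewrite -sub0r; exact: cB.
Qed.

(** Subtracting or adding the indicator of the point brings the value there to 0. *)
Lemma C1_point x h : isolated K x ->
  (forall y, K y -> y <> x -> CZ_val h y = 0) -> C1 (lquot I) (lquot_pi I h).
Proof.
move=> [_ [V /(clopen_nbhs bX)[U [cU Ux UV]] VK]].
have [e1 e1E] := CZ_cst X 1; have [e [eU enU]] := CZ_patch e1 0 cU.
have ex : CZ_val e x = 1 by rewrite eU.
have e0 y : K y -> y <> x -> CZ_val e y = 0.
  move=> Ky yx; rewrite enU // => /UV Vy; apply: yx.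
  by have : (V `&` K) y by []; rewrite VK.
have Ce := C1_indicator e0 ex.
move En : (CZ_val h x) => n.
elim/int_ind: n h En => [|n IH|n IH] h hx h0.
- have [c0 _ _ _] := C1_convex_lsubgroup (lquot I).
  suff -> : lquot_pi I h = lquot_pi I 0 by rewrite lquot_pi0.
  apply/lquot_vanishing_eq => y Ky.
  by have [->|/eqP yx] := eqVneq y x; [rewrite hx|rewrite h0].
- rewrite -(subrK e h) lquot_piD; apply: C1_D => //; apply: IH => [|y Ky yx].
    have -> : CZ_val (h - e) x = CZ_val h x - CZ_val e x by [].
    by rewrite hx ex -addn1 PoszD addrK.
  have -> : CZ_val (h - e) y = CZ_val h y - CZ_val e y by [].
  by rewrite h0 // e0 // subrr.
- rewrite -(addrK e h) lquot_piB; apply: C1_D; last exact: C1_N.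
  apply: IH => [|y Ky yx].
    have -> : CZ_val (h + e) x = CZ_val h x + CZ_val e x by [].
    by rewrite hx ex -addn1 PoszD opprD subrK.
  have -> : CZ_val (h + e) y = CZ_val h y + CZ_val e y by [].
  by rewrite h0 // e0 // addr0.
Qed.

(** The property passed to [compact_ind] says that cutting [f] down to any clopen
    subset of [U] gives an element of the convex subgroup; quantifying over subsets
    makes it stable under unions, as a union can be made disjoint. *)
Lemma C1_of_vanishing f :
  vanishing (K `\` isolated K) f -> C1 (lquot I) (lquot_pi I f).
Proof.
move=> f0.
pose P U := clopen U /\ forall V h, V `<=` U -> clopen V ->
  (forall x, K x -> V x -> CZ_val h x = CZ_val f x) ->
  (forall x, K x -> ~ V x -> CZ_val h x = 0) -> C1 (lquot I) (lquot_pi I h).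
have C10 h : (forall x, K x -> CZ_val h x = 0) -> C1 (lquot I) (lquot_pi I h).
  move=> h0; have [c0 _ _ _] := C1_convex_lsubgroup (lquot I).
  suff -> : lquot_pi I h = lquot_pi I 0 by rewrite lquot_pi0.
  by apply/lquot_vanishing_eq.
have [||x Kx|U [KU [cU PU]]] := @compact_ind X K P (closed_compactX cK).
- split; first exact: clopen0.
  by move=> V h V0 _ _ hV; apply: C10 => x Kx; apply: hV => // /V0.
- move=> U U' [cU PU] [cU' PU']; split; first exact: clopenU.
  move=> V h VUU' cV hV hnV; have [h1 [h1U h1nU]] := CZ_patch h 0 cU.
  have h2E x : CZ_val (h - h1) x = CZ_val h x - CZ_val h1 x by [].
  rewrite -(subrK h1 h) lquot_piD; apply: C1_D.
    apply: (PU' (V `\` U)).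
    + by move=> x [/VUU'[]].
    + by rewrite setDE; apply: clopenI => //; exact: clopenC.
    + by move=> x Kx [Vx nUx]; rewrite h2E h1nU // hV // subr0.
    + move=> x Kx nVU; rewrite h2E; have [Ux|nUx] := pselect (U x).
        by rewrite h1U // subrr.
      by rewrite h1nU // hnV // => Vx; exact: nVU.
  apply: (PU (V `&` U)).
  + by [].
  + exact: clopenI.
  + by move=> x Kx [Vx Ux]; rewrite h1U // hV.
  + move=> x Kx nVU; have [Ux|nUx] := pselect (U x); last by rewrite h1nU.
    by rewrite h1U // hnV // => Vx; exact: nVU.
- have [ix|nix] := pselect (isolated K x).
    have [_ [V /(clopen_nbhs bX)[U [cU Ux UV]] VK]] := ix.
    exists U; split=> //; first by case: cU.
    split=> // U' h U'U cU' hU' hnU'; apply: (C1_point ix) => y Ky yx.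
    apply: hnU' => // /U'U/UV Vy; apply: yx.
    by have : (V `&` K) y by []; rewrite VK.
  have cU := CZ_clopen f [set 0].
  exists [set y | [set 0] (CZ_val f y)]; split; first by case: cU.
    exact: (f0 x).
  split=> // U' h U'U _ hU' hnU'; apply: C10 => y Ky.
  have [U'y|nU'y] := pselect (U' y); last exact: hnU'.
  by rewrite hU' //; exact: U'U.
by apply: (PU U) => // x Kx nUx; case: nUx; exact: KU.
Qed.

End OneStep.

Section Calpha.
Context {d : Order.disp_t} {W : ordType d}.

(** Both sides obey the same recursion.  In the limit case compactness is applied to
    the property that [f] vanishes on the part in [U] of some earlier derivative: a
    point outside [X^(a)] is already outside an earlier derivative, and at a point of
    [X^(a)] the function vanishes on a neighbourhood. *)
Lemma C_seq_vanishing (a : W) :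
  C_seq (CZ X) a = vanishing (CB_derivative X a).
Proof.
elim/(well_founded_ind (@ord_wf d W)): a => a IH.
case: (ordP a) => [a0|c ca|al].
- rewrite /C_seq /CB_derivative !trec0 //; apply/seteqP; split=> f; first by move=> ->.
  by move=> f0; apply: CZ_ext => x; exact: f0.
- have IHc : clsub_set (C_ (CZ X) c) = vanishing (CB_derivative X c) := IH c ca.1.
  rewrite /C_seq (trecS _ _ _ ca) -/(C_seq (CZ X)) /CB_derivative (trecS _ _ _ ca).
  rewrite -/(CB_derivative X); have cK := @closed_CB X d W c.
  apply/seteqP; split=> f.
    by move=> /(C_succE (C_ (CZ X) c)) /(vanishing_of_C1 IHc).
  by move=> f0; apply/(C_succE (C_ (CZ X) c)); exact: C1_of_vanishing cK IHc _ f0.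
- apply/seteqP; split=> f.
    rewrite /C_seq trec_lim // => -[_ [b ba <-] Cf] x.
    by rewrite -/(C_seq (CZ X)) IH // in Cf; move/(CB_le (ltW ba)); exact: Cf.
  move=> f0.
  have [c ca] : exists c, (c < a)%O.
    have [na0 _] := al; have /existsNP[c ac] := na0.
    by exists c; rewrite ltNge; apply/negP.
  have [|||x _|U [KU [b [ba fb]]]] := @compact_ind X setT (fun U =>
      exists b, (b < a)%O /\ forall x, CB_derivative X b x -> U x -> CZ_val f x = 0).
  - by case: bX.
  - by exists c.
  - move=> U V [b [ba bU]] [b' [b'a b'V]]; exists (Order.max b b').
    split; first by rewrite gt_max ba b'a.
    move=> x Bx [Ux|Vx]; [apply: bU => //|apply: b'V => //]; apply: CB_le Bx.
      by rewrite le_max lexx.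
    by rewrite le_max lexx orbT.
  - have [fx|fx] := pselect (CZ_val f x = 0).
      exists [set y | [set 0] (CZ_val f y)]; split=> //.
        by case: (CZ_clopen f [set 0]).
      by exists c; split.
    have : ~ CB_derivative X a x by move=> /f0.
    rewrite /CB_derivative trec_lim // -/(CB_derivative X) => nx.
    have [b [ba nbx]] : exists b, (b < a)%O /\ ~ CB_derivative X b x.
      apply: contrapT => nb; apply: nx => _ [b ba <-].
      by apply: contrapT => nbx; apply: nb; exists b.
    exists (~` CB_derivative X b); split=> //.
      exact/closed_openC/closed_CB.
    by exists b; split.
  rewrite /C_seq trec_lim // -/(C_seq (CZ X)).
  exists (C_seq (CZ X) b); first by exists b.
  by rewrite IH // => x /fb; apply; exact: KU.
Qed.

End Calpha.
End CantorBendixsonCalpha.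

(** * Extension of functions from a closed subset *)

Section Extension.
Variable X : topologicalType.
Hypothesis bX : boolean_space X.

Lemma CZ_restrict (K : set X) (f : CZ X) :
  exists g : CZ (set_type K), forall y, CZ_val g y = CZ_val f (set_val y).
Proof.
have gc : continuous ((fun y : set_type K => CZ_val f (set_val y)) :
    set_type K -> discrete_topology int).
  apply: CZ_cont => y.
  exact: (@initial_continuous (set_type K) X set_val y _ (CZ_near f (set_val y))).
by exists (mkcts gc : continuousType (set_type K) (discrete_topology int)).
Qed.

(** Locally a constant function extends the given one. *)
Lemma CZ_extend (K : set X) (g : CZ (set_type K)) : closed K ->
  exists f : CZ X, forall y, CZ_val f (set_val y) = CZ_val g y.
Proof.
move=> cK.
have [|U V|x Kx|U [KU [_ [f fg]]]] := @compact_ind X K (fun U => clopen U /\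
    exists f : CZ X, forall y, U (set_val y) -> CZ_val f (set_val y) = CZ_val g y)
  (closed_compactX bX cK).
- by split; [exact: clopen0|exists 0].
- move=> [cU [f fU]] [cV [h hV]]; split; first exact: clopenU.
  have [k [kU knU]] := CZ_patch f h cU; exists k => y UVy.
  have [Uy|nUy] := pselect (U (set_val y)); first by rewrite kU // fU.
  by rewrite knU // hV //; case: UVy.
- pose y : set_type K := exist _ x (mem_set Kx).
  have [_ [[V oV <-] /= Vx VE]] := CZ_near g y.
  have [D [cD Dx DV]] := clopen_nbhs bX (open_nbhs_nbhs (conj oV Vx)).
  exists D; split=> //; first by case: cD.
  split=> //; have [f fE] := CZ_cst X (CZ_val g y).
  by exists f => z Dz; rewrite fE; apply/esym/VE/DV.
by exists f => y; apply/fg/KU/set_mem; exact: (valP y).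
Qed.

(** The isomorphism is taken from functions on [K] to cosets, choosing extensions; the
    choice is immaterial modulo functions vanishing on [K]. *)
Lemma restriction_iso (K : set X) (I : clsub (CZ X)) :
  closed K -> clsub_set I = vanishing K ->
  lgroup_iso (CZ (set_type K)) (lquot I).
Proof.
move=> cK IK.
pose ext (g : CZ (set_type K)) := sval (cid (CZ_extend g cK)).
have extE g y : CZ_val (ext g) (set_val y) = CZ_val g y.
  exact: (svalP (cid (CZ_extend g cK))).
pose phi (g : CZ (set_type K)) := lquot_pi I (ext g).
have phiE g f : (forall y, CZ_val g y = CZ_val f (set_val y)) ->
    phi g = lquot_pi I f.
  move=> gf; apply/(lquot_vanishing_eq IK) => x Kx.
  by have := extE g (exist _ x (mem_set Kx)); rewrite gf.
pose psi (u : lquot I) := sval (cid (CZ_restrict K (sval (cid (lquot_pi_surj u))))).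
exists phi; split.
- exists psi => [g|u].
    apply: CZ_ext => y.
    rewrite /psi; case: cid => f /= fE; case: cid => h /= hE; rewrite hE -extE.
    have /(lquot_vanishing_eq IK) := fE; apply.
    by apply/set_mem; exact: (valP y).
  rewrite /psi; case: cid => f /= <-; case: cid => h /= hE; exact: phiE.
- move=> g h; rewrite (phiE _ (ext g + ext h)) ?lquot_piD // => y.
  have [-> _ _ _] := CZ_valE (ext g) (ext h) (set_val y).
  by rewrite !extE; have [-> _ _ _] := CZ_valE g h y.
- move=> g h; rewrite (phiE _ (ext g /\_ ext h)) ?lquot_piI // => y.
  have [_ _ -> _] := CZ_valE (ext g) (ext h) (set_val y).
  by rewrite !extE; have [_ _ -> _] := CZ_valE g h y.
- move=> g h; rewrite (phiE _ (ext g \/_ ext h)) ?lquot_piU // => y.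
  have [_ _ _ ->] := CZ_valE (ext g) (ext h) (set_val y).
  by rewrite !extE; have [_ _ _ ->] := CZ_valE g h y.
Qed.

End Extension.

(** * The lattice of positive elements and infinity *)

Section PosinfCongruences.
Variable G : lgroupType.
Implicit Types (x y z s t : G) (u v w : posinf G) (I J : clsub G).

(** Congruence modulo a subgroup, extended to infinity as a class of its own. *)
Definition posinf_rel (S : G -> Prop) u v : Prop :=
  match u, v with
  | None, None => True
  | Some a, Some b => S (val a - val b)
  | _, _ => False
  end.

Lemma posinf_rel_congruence J : congruence (posinf_rel J).
Proof.
have [J0 JB _ _] := clsubP J; split.
- by case=> [a|] //=; rewrite subrr.
- by move=> [a|] [b|] //= /clsub_opp; rewrite opprB.
- by move=> [a|] [b|] [c|] //= ab /clsub_opp bc;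
    have := JB _ _ ab bc; rewrite opprK addrA subrK.
- move=> [a|] [a'|] [b|] [b'|] //= aa' bb'; split=> //=.
    exact: clsub_meet.
  exact: clsub_join.
Qed.

Definition posinf_some x (x0 : 0 <= x) : posinf G := Some (exist _ x x0).

Variables (R : congr_of (posinf G)) (I : clsub G).
Hypothesis RI : forall u v, R u v <-> posinf_rel I u v.

Let pi := latq_pi R.

Lemma latq_pi_surj (a : latq R) : exists u, pi u = a.
Proof. by exists (latq_repr a); exact: generic_quotient.reprK. Qed.

Lemma latq_le u v : pi u <= pi v <-> posinf_rel I (u /\_ v) u.
Proof. by rewrite leEmeet -latq_piI; split=> [/eqP/latq_piE/RI|/RI/latq_piE/eqP]. Qed.

Lemma latq_pos_le x y (x0 : 0 <= x) (y0 : 0 <= y) :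
  pi (posinf_some x0) <= pi (posinf_some y0) <-> lquot_pi I x <= lquot_pi I y.
Proof. by split=> [/latq_le/lquot_le_meet|/lquot_le_meet ?]; last exact/latq_le. Qed.

Lemma latq_pos_eq x y (x0 : 0 <= x) (y0 : 0 <= y) :
  pi (posinf_some x0) = pi (posinf_some y0) <-> lquot_pi I x = lquot_pi I y.
Proof. by split=> [/latq_piE/RI/lquot_piE|/lquot_piE ?]; last exact/latq_piE/RI. Qed.

Lemma latq_infty u : pi None <= pi u -> u = None.
Proof. by move/latq_le; case: u. Qed.

(** Positive cosets have positive representatives, which makes intervals of the
    quotient group between positive elements intervals of the quotient lattice. *)
Lemma lquot_pos (a : lquot I) : 0 <= a -> exists x (x0 : 0 <= x), lquot_pi I x = a.
Proof.
have [x <-] := lquot_pi_surj a => x0.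
exists (x \/_ 0), (leUr _ _); by rewrite lquot_piU lquot_pi0 (join_l x0).
Qed.

Lemma lquot_pi_ge0 x : 0 <= x -> 0 <= lquot_pi I x.
Proof.
move=> x0; rewrite -(lquot_pi0 I); apply/lquot_le_meet.
by rewrite (meet_l x0) subrr; case: (clsubP I).
Qed.

(** Every element between two finite ones is finite, so such an interval is the same
    in the quotient lattice and in the quotient group. *)
Lemma latq_at_most_two x y (x0 : 0 <= x) (y0 : 0 <= y) :
  lquot_pi I x <= lquot_pi I y ->
  at_most_two (pi (posinf_some x0)) (pi (posinf_some y0)) <->
  at_most_two (lquot_pi I x) (lquot_pi I y).
Proof.
move=> xy; have xy' : pi (posinf_some x0) <= pi (posinf_some y0) by exact/latq_pos_le.
split=> [/(at_most_twoP xy') H|/(at_most_twoP xy) H].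
- apply/(at_most_twoP xy) => a xa ay.
  have [z [z0 za]] := lquot_pos (le_trans (lquot_pi_ge0 x0) xa).
  rewrite -za in xa ay *.
  have [/latq_pos_eq|/latq_pos_eq] := H (pi (posinf_some z0))
    ((latq_pos_le x0 z0).2 xa) ((latq_pos_le z0 y0).2 ay); by [left|right].
- apply/(at_most_twoP xy') => a.
  have [[[z z0]|] <-] := latq_pi_surj a => [xz zy|_ /latq_infty//].
  have [|] := H (lquot_pi I z) ((latq_pos_le x0 z0).1 xz) ((latq_pos_le z0 y0).1 zy).
    by move/(latq_pos_eq z0 x0); left.
  by move/(latq_pos_eq z0 y0); right.
Qed.

Lemma lquot_pos_notin : (exists x, ~ I x) -> exists x, 0 <= x /\ ~ I x.
Proof.
have [I0 IB _ _] := clsubP I => -[x nIx].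
have [Ip|nIp] := pselect (I (x \/_ 0)); last by exists (x \/_ 0); rewrite leUr.
exists (- (x /\_ 0)); rewrite -[leLHS]oppr0 lg_leN leIr; split=> // In.
apply: nIx; have := IB _ _ Ip In; rewrite opprK addrC.
by rewrite lg_meet_join addr0.
Qed.

Section Step.
Variable J : clsub G.
Hypothesis JI : forall x, J x <-> C1 (lquot I) (lquot_pi I x).

Let IJ x : I x -> J x.
Proof.
move=> Ix; apply/JI; have -> : lquot_pi I x = lquot_pi I 0.
  by apply/lquot_piE; rewrite subr0.
by rewrite lquot_pi0; have [] := C1_convex_lsubgroup (lquot I).
Qed.

Let IJ_rel u v : posinf_rel I u v -> posinf_rel J u v.
Proof. by case: u v => [a|] [b|] //= /IJ. Qed.

Lemma simple_congr_chain s t (s0 : 0 <= s) (t0 : 0 <= t) :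
  simple_chain (lquot_pi I s) (lquot_pi I t) ->
  simple_congr (pi (posinf_some s0)) (pi (posinf_some t0)).
Proof.
move=> [n [c [cs ct cS]]].
have [Sr _ St _] := simple_congr_congruence (latq R).
have H : forall i, (i <= n)%N -> exists x (x0 : 0 <= x), lquot_pi I x = c i /\
    simple_congr (pi (posinf_some s0)) (pi (posinf_some x0)).
  elim=> [_|i IH ni]; first by exists s, s0; split; [rewrite cs|exact: Sr].
  have [x [x0 [xc sx]]] := IH (ltnW ni); have [le2 two] := cS i ni.
  have [|z [z0 zc]] := @lquot_pos (c i.+1).
    by apply: le_trans le2; rewrite -xc lquot_pi_ge0.
  rewrite -xc -zc in le2 two; exists z, z0; split=> //; apply: St sx _.
  move=> T _; apply; first exact/latq_pos_le.
  exact/(latq_at_most_two x0 z0 le2).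
have [x [x0 [xc sx]]] := H n (leqnn n).
suff <- : pi (posinf_some x0) = pi (posinf_some t0) by [].
by apply/latq_pos_eq; rewrite xc ct.
Qed.

(** One step of the construction of the m-dimension is one step of the construction
    of the [C_a].  If [x - y] is in [J], translating its chain by [y] gives a chain of
    simple intervals from the meet to the join of [x] and [y], all of whose terms are
    congruent.  Conversely [J] defines a congruence, and it identifies the endpoints
    of simple intervals. *)
Lemma simple_congr_posinf u v : (exists x, ~ I x) ->
  simple_congr (pi u) (pi v) <-> posinf_rel J u v.
Proof.
move=> nI; split; last first.
  have [Sr Ss St SL] := simple_congr_congruence (latq R).
  case: u v => [[x x0]|] [[y y0]|] //= /JI.
  rewrite /C1 /= -(lquot_pi0 I) -lquot_piI -lquot_piU.
  move/(simple_chain_add (lquot_pi I y)).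
  rewrite -!lquot_piD lg_meetD lg_joinD addr0 addrC subrK.
  have m0 : 0 <= x /\_ y by rewrite lexI x0 y0.
  have j0 : 0 <= x \/_ y by rewrite (le_trans x0) ?leUl.
  move/(simple_congr_chain m0 j0) => mj.
  have sub z (z0 : 0 <= z) : x /\_ y <= z -> z <= x \/_ y ->
      simple_congr (pi (posinf_some m0)) (pi (posinf_some z0)).
    move=> mz zj; have := (SL _ _ _ _ mj (Sr (pi (posinf_some z0)))).1.
    have -> : pi (posinf_some m0) /\_ pi (posinf_some z0) = pi (posinf_some m0).
      by apply/meet_l/latq_pos_le/lquot_le_meet; rewrite (meet_l mz) subrr; case: (clsubP I).
    have -> // : pi (posinf_some j0) /\_ pi (posinf_some z0) = pi (posinf_some z0).
    by apply/meet_r/latq_pos_le/lquot_le_meet; rewrite (meet_l zj) subrr; case: (clsubP I).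
  apply: (St _ (pi (posinf_some m0))); first apply: Ss; apply: sub.
  + exact: leIl.
  + exact: leUl.
  + exact: leIr.
  + exact: leUr.
have [Jr Js Jt JL] := posinf_rel_congruence J.
pose S (a b : latq R) := posinf_rel J (latq_repr a) (latq_repr b).
have reprE w : posinf_rel J (latq_repr (pi w)) w.
  by apply/IJ_rel/RI/latq_piE; rewrite /latq_repr /pi /latq_pi generic_quotient.reprK.
have SE w w' : S (pi w) (pi w') <-> posinf_rel J w w'.
  split=> [h|h].
    exact: Jt (Jt _ _ _ (Js _ _ (reprE w)) h) (reprE w').
  exact: Jt (Jt _ _ _ (reprE w) h) (Js _ _ (reprE w')).
move=> /(_ S) h; apply/SE/h => {h u v}.
  split.
  + by move=> a; exact: Jr.
  + by move=> a b; exact: Js.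
  + by move=> a b c; exact: Jt.
  + move=> a a' b b'; have [u <-] := latq_pi_surj a; have [u' <-] := latq_pi_surj a'.
    have [v <-] := latq_pi_surj b; have [v' <-] := latq_pi_surj b'.
    by rewrite -!latq_piI -!latq_piU !SE => ? ?; exact: JL.
move=> a b; have [[[x x0]|] <-] := latq_pi_surj a;
  have [[[y y0]|] <-] := latq_pi_surj b.
- move/(latq_pos_le x0 y0) => xy /(latq_at_most_two x0 y0 xy)/(at_most_two_chain xy) ch.
  apply/SE => /=; apply/JI/C1P; rewrite lquot_piB.
  exists (lquot_pi I x - lquot_pi I y), 0; split=> //.
  + by rewrite -(subrr (lquot_pi I y)) lg_le2r.
  + by rewrite -(subrr (lquot_pi I y)) lg_le2r.
  + have := simple_chain_add (- lquot_pi I y) ch.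
    by rewrite addNr addrC.
(* An interval [x, oo] is never simple, as it contains x + z for every z
   outside of I. *)
- move=> _ two; have [z [z0 nIz]] := lquot_pos_notin nI; exfalso.
  have xz0 : 0 <= x + z by rewrite -[0]addr0 lg_leD.
  have le_oo w : pi w <= pi None.
    by apply/latq_le; case: w => [w|] //=; rewrite subrr; case: (clsubP I).
  have [||xzx|xzoo] := (at_most_twoP (le_oo (posinf_some x0))).1 two (pi (posinf_some xz0)).
  + apply/latq_pos_le; rewrite lquot_piD -[leLHS]addr0 lg_le2l; exact: lquot_pi_ge0.
  + exact: le_oo.
  + by move/latq_pos_eq/lquot_piE: xzx; rewrite addrAC subrr add0r.
  + by move/latq_piE/RI: xzoo.
- by move/latq_infty.
- by move=> _ _; apply/SE.
Qed.
End Step.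

(** Once the subgroup is everything, the lattice has only two elements left, and
    its one interval is collapsed. *)
Lemma simple_congr_full u v : (forall x, I x) -> simple_congr (pi u) (pi v).
Proof.
move=> II; have [Sr Ss St _] := simple_congr_congruence (latq R).
have oo w : simple_congr (pi w) (pi None).
  case: w => [w|]; last exact: Sr.
  move=> T _; apply; first by apply/latq_le => /=.
  apply/at_most_twoP => [|a]; first by apply/latq_le => /=.
  have [[z|] <-] := latq_pi_surj a => _ _; [left|by right].
  by apply/latq_piE/RI => /=.
exact: St (oo u) (Ss _ _ (oo v)).
Qed.

End PosinfCongruences.

(** * The m-dimension of the positive cone *)

Section MDimension.
Variable G : lgroupType.
Context {d : Order.disp_t} {W : ordType d}.
Implicit Types a b c : W.

(** Properness of the earlier groups is what keeps infinity apart from the finite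
    elements: it is merged at the step following the first [c] with [C_c] total. *)
Lemma mdim_kerE a : (forall c, (c < a)%O -> exists x, ~ C_seq G c x) ->
  forall u v : posinf G, mdim_ker a u v <-> posinf_rel (C_seq G a) u v.
Proof.
elim/(well_founded_ind (@ord_wf d W)): a => a IH Ha.
have {}IH c u v : (c < a)%O -> mdim_ker c u v <-> posinf_rel (C_seq G c) u v.
  by move=> ca; apply: IH => // e ec; apply: Ha; exact: lt_trans ca.
case: (ordP a) => [a0|c ca|al] u v.
- rewrite /mdim_ker /C_seq !trec0 //; case: u v => [x|] [y|] //=; split=> //.
  + by move=> [->]; rewrite subrr.
  + by move/eqP; rewrite subr_eq0 => /eqP/val_inj ->.
- rewrite /mdim_ker (trecS _ _ _ ca) -/(mdim_ker _) /mdim_ker_succ.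
  case: pselect => [h|/(_ (mdim_ker_congruence _ _))//].
  rewrite (@simple_congr_posinf G (Congr h) (C_ G c) _ (C_ G a)) //.
  + by move=> u' v'; exact: IH ca.1.
  + move=> x /=; rewrite /C_seq (trecS _ _ _ ca) -/(C_seq G).
    exact: (C_succE (C_ G c)).
  + exact: Ha ca.1.
- rewrite /mdim_ker /C_seq !trec_lim //; split.
    move=> [_ [c ca <-]] /(IH c u v ca); case: u v => [x|] [y|] //= Cxy.
    by exists (C_seq G c) => //; exists c.
  have [c0 c0a] : exists c, (c < a)%O.
    have [na0 _] := al; have /existsNP[c ac] := na0.
    by exists c; rewrite ltNge; apply/negP.
  case: u v => [x|] [y|] //=.
    by move=> [_ [c ca <-] Cxy]; exists (mdim_ker c); [exists c|apply/(IH c _ _ ca)].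
  by move=> _; exists (mdim_ker c0); [exists c0|apply/(IH c0 _ _ c0a)].
Qed.

(** [L_b] has two elements, infinity and the class of all finite elements, so
    the next quotient is the first that is a point. *)
Lemma has_mdim_lgroup b : (forall c, (c < b)%O -> exists x, ~ C_seq G c x) ->
  (forall x, C_seq G b x) -> has_mdim (posinf G) b.
Proof.
move=> Hb Gb; have ab := osuccP b; set a := osucc b in ab *.
split; first by exists None, (posinf_some (lexx 0)).
exists a; split=> //.
- pose pi := latq_pi (Congr (mdim_ker_congruence (posinf G) a)).
  exists (pi None) => s; have [u <-] := latq_pi_surj s.
  apply/latq_piE => /=.
  rewrite /mdim_ker (trecS _ _ _ ab) -/(mdim_ker _) /mdim_ker_succ.
  case: pselect => // h; apply: (@simple_congr_full G (Congr h) (C_ G b)) => //.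
  exact: mdim_kerE.
- move=> c [t ct]; rewrite leNgt; apply/negP => ca.
  have cb := is_succ_lt ab ca.
  pose pi := latq_pi (Congr (mdim_ker_congruence (posinf G) c)).
  have : pi None = pi (posinf_some (lexx 0)).
    by rewrite (ct (pi None)) (ct (pi (posinf_some _))).
  move/latq_piE => /=.
  by move/(mdim_kerE (fun e ec => Hb e (lt_le_trans ec cb))).
Qed.

End MDimension.

(** * The Cantor-Bendixson rank *)

Section CBRank.
Variable X : topologicalType.
Hypothesis bX : boolean_space X.
Context {d : Order.disp_t} {W : ordType d}.
Implicit Types a b c : W.

(** The constant function 1 tells whether a derivative is empty. *)
Lemma C_seq_proper a : CB_derivative X a !=set0 <-> exists f, ~ C_seq (CZ X) a f.
Proof.
rewrite C_seq_vanishing //; split=> [[x ax]|[f nf]].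
  have [f fE] := CZ_cst X 1; exists f => /(_ x ax).
  by rewrite fE.
apply: contrapT => nax; apply: nf => x ax; exfalso; apply: nax; by exists x.
Qed.

(** The rank is a supremum; it is a maximum because a limit of non-empty derivatives
    is non-empty: otherwise the constant 1 would be in [C_b], hence in an earlier
    [C_c], so that [X^(c)] would be empty with [c < b]. *)
Lemma CB_rank_attained b : has_CB_rank X b -> CB_derivative X b !=set0.
Proof.
move=> [[x0 _] [ub lub]]; case: (ordP b) => [b0|c cb|bl].
- by rewrite /CB_derivative trec0 //; exists x0.
- apply: contrapT => nb.
  have : (b <= c)%O.
    apply: lub => a na; apply: (is_succ_lt cb); rewrite lt_neqAle.
    by apply/andP; split; [apply/eqP => ab; rewrite ab in na|exact: ub].
  by rewrite leNgt cb.1.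
- apply/C_seq_proper; have [e eE] := CZ_cst X 1; exists e.
  rewrite /C_seq trec_lim // => -[_ [c cb <-]].
  rewrite -/(C_seq (CZ X)) C_seq_vanishing // => ce.
  have c0 x : ~ CB_derivative X c x by move/ce; rewrite eE.
  have : (b <= c)%O.
    apply: lub => a [x ax]; rewrite leNgt; apply/negP => ca.
    exact: (c0 x (CB_le (ltW ca) ax)).
  by rewrite leNgt cb.
Qed.

End CBRank.

Theorem lemma8p8 (X : topologicalType) (hX : boolean_space X)
    (d : Order.disp_t) (W : ordType d) :
  (forall a : W,
     lgroup_iso (CZ (set_type (CB_derivative X a))) (lquot (C_ (CZ X) a))) /\
  (forall b : W, has_CB_rank X b -> has_mdim (posinf (CZ X)) (osucc b)).
Proof.
split=> [a|b rb].
  apply: (restriction_iso hX); first exact: closed_CB.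
  exact: C_seq_vanishing.
have bS := osuccP b; apply: has_mdim_lgroup => [c /(is_succ_lt bS) cb|f].
  apply/(C_seq_proper hX); have [x bx] := CB_rank_attained hX rb.
  by exists x; exact: CB_le bx.
apply: contrapT => nf; have [_ [ub _]] := rb.
have : (osucc b <= b)%O by apply: ub; apply/(C_seq_proper hX); exists f.
by rewrite leNgt bS.1.
Qed.
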